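(* Let $G$ be a planar graph with a fixed planar embedding as in the context. Then the map $b$, sending a linear extension $a_1a_2\cdots a_m$ of $P_G$ to the set of routes $\{R_{\{a_1,\dots,a_k\}}:0\le k\le m\}$, is a bijection between the set of linear extensions of $P_G$ and the set of maximal cliques of $G$ with respect to the planar framing.
   Context: Let $G$ be a finite connected loopless directed multigraph on $[n]$, edges directed from smaller to larger endpoint, each $v\in\{2,\dots,n-1\}$ having both incoming and outgoing edges. $G$ is planar if it has a crossing-free drawing in the plane with $1,2,\dots,n$ placed in this order on a horizontal line (edges drawn as curves going from left to right); fix such a drawing. $P_G$ is the poset whose elements are the bounded regions (faces) of the drawing, with $x$ covered by $x'$ whenever an edge of $G$ separates $x$ (below) from $x'$ (above); i.e. the Hasse diagram of $P_G$ is the dual graph with the infinite face removed, oriented from lower to higher. A route is a directed path from $1$ to $n$. For an order ideal $I$ of $P_G$, $R_I$ denotes the route forming the upper boundary of the union of the regions in $I$ (the unique route with exactly the regions of $I$ below it; $R_\varnothing$ is the lowest route). The planar framing orders, at each inner vertex $v$, both the incoming edges and the outgoing edges top to bottom. Coherence: given a framing (orders $\prec_{in(v)},\prec_{out(v)}$ at each inner vertex $v$), order paths from $1$ to $v$ by: for distinct $P,Q$ let $w$ be the largest vertex such that they coincide from $w$ to $v$ and their edges entering $w$ differ, and compare these edges by $\prec_{in(w)}$; order paths from $v$ to $n$ analogously (smallest vertex $w$ after which they differ, compare outgoing edges by $\prec_{out(w)}$). For routes $P,Q$ through an inner vertex $v$, with $Pv$, $vP$ the parts before/after $v$, $P$ and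 $Q$ are coherent at $v$ unless ($Pv\prec Qv$ and $vQ\prec vP$) or ($Qv\prec Pv$ and $vP\prec vQ$); they are coherent if coherent at all common inner vertices. A clique is a set of pairwise coherent routes; a maximal clique is one maximal under inclusion. *)

(* Defs.v *)
From Stdlib Require Export Relation_Operators.
From HB Require Export structures.
From mathcomp Require Export all_boot all_order all_algebra.
From mathcomp Require Export all_classical all_reals all_analysis.

Set Implicit Arguments.
Unset Strict Implicit.
Unset Printing Implicit Defensive.

Export Order.TTheory GRing.Theory Num.Theory.
Export numFieldNormedType.Exports.

Global Open Scope classical_set_scope.
Global Open Scope ring_scope.

(* A graph on n + 1 vertices: the vertices 1, ..., n + 1 of the text are
   0, ..., n here, so the source is ord0, the sink is ord_max, and the inner
   vertices are all the others. *)
Definition inner (n : nat) (v : 'I_n.+1) : bool :=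
  (v != ord0) && (v != ord_max).

Record dgraph (n : nat) := DGraph {
  edge : finType;
  src : edge -> 'I_n.+1;
  tgt : edge -> 'I_n.+1;
  src_lt_tgt : forall e, (src e < tgt e)%N;
  dgraph_connected : forall u v,
    connect (fun x y => [exists e, ((src e == x) && (tgt e == y))
                                   || ((src e == y) && (tgt e == x))]) u v;
  inner_in : forall v, inner v -> exists e, tgt e = v;
  inner_out : forall v, inner v -> exists e, src e = v
}.
Arguments src {n d} _.
Arguments tgt {n d} _.

Section Routes.
Variables (n : nat) (G : dgraph n).

Fixpoint dipath (u : 'I_n.+1) (p : seq (edge G)) (v : 'I_n.+1) : bool :=
  if p is e :: p' then (src e == u) && dipath (tgt e) p' v else u == v.

Definition route (p : seq (edge G)) : bool := dipath ord0 p ord_max.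

(* [fr_in v e e'] is e ≺_in(v) e', and is only used when e and e' both enter
   v; similarly for [fr_out]. *)
Record framing := Framing {
  fr_in : 'I_n.+1 -> edge G -> edge G -> Prop;
  fr_out : 'I_n.+1 -> edge G -> edge G -> Prop
}.

Variable fr : framing.

(* The common part S runs from w to the common endpoint of P and Q. *)
Definition prec_before (P Q : seq (edge G)) : Prop :=
  exists w P' Q' S e e',
    [/\ P = rcons P' e ++ S, Q = rcons Q' e' ++ S, e <> e',
        tgt e = w /\ tgt e' = w & fr_in fr w e e'].

Definition prec_after (P Q : seq (edge G)) : Prop :=
  exists w P' Q' S e e',
    [/\ P = S ++ e :: P', Q = S ++ e' :: Q', e <> e',
        src e = w /\ src e' = w & fr_out fr w e e'].

(* [splits v P Pv vP]: the route P passes through v, with parts Pv before v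
   and vP after v. *)
Definition splits (v : 'I_n.+1) (P Pv vP : seq (edge G)) : Prop :=
  [/\ P = Pv ++ vP, dipath ord0 Pv v & dipath v vP ord_max].

Definition coherent_at (v : 'I_n.+1) (P Q : seq (edge G)) : Prop :=
  forall Pv vP Qv vQ, splits v P Pv vP -> splits v Q Qv vQ ->
    ~ ((prec_before Pv Qv /\ prec_after vQ vP) \/
       (prec_before Qv Pv /\ prec_after vP vQ)).

Definition coherent (P Q : seq (edge G)) : Prop :=
  forall v, inner v -> coherent_at v P Q.

Definition clique (C : set (seq (edge G))) : Prop :=
  (forall P, C P -> route P) /\ (forall P Q, C P -> C Q -> coherent P Q).

Definition maximal_clique (C : set (seq (edge G))) : Prop :=
  clique C /\ forall C', clique C' -> C `<=` C' -> C' = C.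

End Routes.

Section Drawing.
Variables (R : realType) (n : nat) (G : dgraph n).

(* A curve going from left to right is the graph of a continuous function
   [height e] on the interval between the abscissae of its endpoints; outside
   of this interval the values of [height e] are irrelevant. *)
Record drawing := Drawing {
  level : R;
  abscissa : 'I_n.+1 -> R;
  height : edge G -> R -> R;
  abscissa_lt : forall u v : 'I_n.+1, (u < v)%N -> abscissa u < abscissa v;
  height_continuous : forall e,
    {within `[abscissa (src e), abscissa (tgt e)], continuous (height e)};
  height_src : forall e, height e (abscissa (src e)) = level;
  height_tgt : forall e, height e (abscissa (tgt e)) = level
}.

Variable D : drawing.

Definition point (v : 'I_n.+1) : R * R := (abscissa D v, level D).

Definition curve (e : edge G) : set (R * R) :=
  [set p | abscissa D (src e) <= p.1 <= abscissa D (tgt e)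
           /\ p.2 = height D e p.1].

Definition crossing_free : Prop :=
  (forall e v, curve e (point v) -> v = src e \/ v = tgt e) /\
  (forall e e' p, e <> e' -> curve e p -> curve e' p ->
     exists v, [/\ p = point v, v = src e \/ v = tgt e
                 & v = src e' \/ v = tgt e']).

Definition support : set (R * R) :=
  \bigcup_(e in [set: edge G]) curve e `|` range point.

Definition bounded_face (F : set (R * R)) : Prop :=
  (exists2 p, ~ support p & F = connected_component (~` support) p)
  /\ bounded_set F.

Definition separates (e : edge G) (F F' : set (R * R)) : Prop :=
  forall x, abscissa D (src e) < x < abscissa D (tgt e) ->
    \forall d \near 0^'+, F (x, height D e x - d) /\ F' (x, height D e x + d).

Definition face_adj (F F' : set (R * R)) : Prop :=
  [/\ bounded_face F, bounded_face F' & exists e, separates e F F'].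

(* The order of P_G. A pair in [face_adj] need not be a covering pair: for two
   faces that share an edge there can be a third one between them. *)
Definition face_le : set (R * R) -> set (R * R) -> Prop :=
  clos_refl_trans _ face_adj.

Definition linear_extension (a : seq (set (R * R))) : Prop :=
  [/\ uniq a, (forall F, F \in a <-> bounded_face F)
    & forall i j, (i < size a)%N -> (j < size a)%N ->
        face_le (nth set0 a i) (nth set0 a j) -> (i <= j)%N].

Definition below_route (F : set (R * R)) (r : seq (edge G)) : Prop :=
  forall p, F p -> exists2 e, e \in r &
    abscissa D (src e) <= p.1 <= abscissa D (tgt e) /\ p.2 < height D e p.1.

(* R_I: the route with exactly the faces of I below it (the empty sequence if
   there is no such route). *)
Definition ideal_route (I : set (set (R * R))) : seq (edge G) :=
  xget [::] [set r | route r /\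
    forall F, bounded_face F -> (below_route F r <-> I F)].

Definition bmap (a : seq (set (R * R))) : set (seq (edge G)) :=
  [set ideal_route [set F | F \in take k a] | k in [set k | (k <= size a)%N]].

(* Top to bottom: e precedes e' at v if e is above e' near v. *)
Definition planar_framing : framing G := {|
  fr_in := fun v e e' =>
    \forall x \near (abscissa D v)^'-, height D e' x < height D e x;
  fr_out := fun v e e' =>
    \forall x \near (abscissa D v)^'+, height D e' x < height D e x
|}.

End Drawing.

(* Main.v *)
Require Import Defs.
From mathcomp Require Import zify ring lra.

(** Clamping each edge curve to its interval makes a route the graph of a
    continuous function. For the planar framing, two routes are coherent iff
    their graphs do not cross: at the last point before a crossing where one of
    them runs strictly below the other, they share a vertex at which they are
    incoherent. So cliques are chains of routes for the pointwise order.

    A bounded face lies on one side of each route, and two routes with the same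
    faces below them coincide. Given an order ideal [I], call an edge a cut edge
    if the face below it is in [I] or unbounded and the face above it is not in
    [I]. A vertical line that avoids the vertices meets the bounded faces in a
    chain of the poset, hence crosses exactly one cut edge; this forces the cut
    edges to form a route, with exactly the faces of [I] below it. Routes are
    thus order ideals, and maximal chains of ideals are linear extensions. *)

Set Implicit Arguments.
Unset Strict Implicit.
Unset Printing Implicit Defensive.

(** * Directed paths *)

Section Paths.
Context (n : nat) (G : dgraph n).
Implicit Types (p q P Q S : seq (edge G)) (e : edge G) (u v w : 'I_n.+1).

Lemma dipath_cat u v p q :
  dipath u (p ++ q) v <-> exists2 w, dipath u p w & dipath w q v.
Proof.
elim: p u => [|e p IH] u /=.
  split=> [upv|[w /eqP <- //]]; by exists u.
split=> [/andP[-> /IH[w]]|[w /andP[-> pw] qv]]; first by exists w.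
by apply/IH; exists w.
Qed.

Lemma dipath_le u p v : dipath u p v -> (u <= v)%N.
Proof.
elim: p u => [|e p IH] u /= => [/eqP -> //|/andP[/eqP <- /IH]].
by apply: leq_trans; apply/ltnW/src_lt_tgt.
Qed.

Lemma dipath_loop u p : dipath u p u -> p = [::].
Proof.
case: p => [//|e p] /= /andP[/eqP eu /dipath_le].
by rewrite -eu leqNgt src_lt_tgt.
Qed.

(** Walking backwards along incoming edges must end at the source. The sink is excluded because
    [inner_in] speaks of inner vertices only. *)
Lemma dipath_from_source v : v != ord_max -> exists p, dipath ord0 p v.
Proof.
have [k] := ubnP (v : nat); elim: k v => // k IH v lt_vk v_max.
have [->|v0] := eqVneq v ord0; first by exists [::] => /=.
have [|e ev] := @inner_in _ G v; first by rewrite /inner v0.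
have lt_sv : (src e < v)%N by rewrite -ev src_lt_tgt.
have [||p pe] := IH (src e).
- by lia.
- by rewrite -val_eqE /=; have := ltn_ord v; lia.
exists (p ++ [:: e]); apply/dipath_cat; exists (src e) => //=.
by rewrite ev !eqxx.
Qed.

Lemma dipath_to_sink v : v != ord0 -> exists p, dipath v p ord_max.
Proof.
have [k] := ubnP (n - v); elim: k v => // k IH v lt_vk v0.
have [->|vmax] := eqVneq v ord_max; first by exists [::] => /=.
have [|e ev] := @inner_out _ G v; first by rewrite /inner v0.
have lt_vt : (v < tgt e)%N by rewrite -ev src_lt_tgt.
have [||p pe] := IH (tgt e).
- by have := ltn_ord (tgt e); lia.
- by rewrite -val_eqE /=; lia.
by exists (e :: p) => /=; rewrite ev eqxx.
Qed.

Lemma route_through e : exists2 p, route p & e \in p.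
Proof.
have lt_st := src_lt_tgt e.
have [|p pe] := @dipath_from_source (src e).
  by rewrite -val_eqE /=; have := ltn_ord (tgt e); lia.
have [|q qe] := @dipath_to_sink (tgt e); first by rewrite -val_eqE /=; lia.
exists (p ++ e :: q); last by rewrite mem_cat inE eqxx orbT.
by apply/dipath_cat; exists (src e) => //=; rewrite eqxx.
Qed.

Lemma dipath_split u p v e : dipath u p v -> e \in p ->
  exists p1 p2, [/\ p = p1 ++ e :: p2, dipath u p1 (src e)
                  & dipath (tgt e) p2 v].
Proof.
move=> pv ep; case/splitPr: ep pv => p1 p2 /dipath_cat[w p1w /=].
by move=> /andP[/eqP sw p2v]; exists p1, p2; rewrite sw.
Qed.

(** Vertices increase along a path, so no path to the sink is a proper initial part of another one;
    two distinct paths must part at some vertex. *)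
Lemma dipath_fork v P Q : dipath v P ord_max -> dipath v Q ord_max -> P <> Q ->
  exists w S e e' P' Q', [/\ P = S ++ e :: P', Q = S ++ e' :: Q', e <> e',
    src e = w /\ src e' = w & dipath v S w].
Proof.
elim: P Q v => [|e P IH] [|e' Q] v //=.
- by move=> /eqP -> Qm; have := @dipath_loop _ (e' :: Q) Qm.
- by move=> Pm /eqP vm; rewrite vm in Pm; have := @dipath_loop _ (e :: P) Pm.
move=> /andP[/eqP ev Pm] /andP[/eqP e'v Qm] neq.
have [ee'|ee'] := eqVneq e e'; last first.
  exists v, [::], e, e', P, Q; split=> //=; exact/eqP.
rewrite -ee' in Qm; have [|w [S [f [f' [P' [Q' [-> -> ff' fw Sw]]]]]]] :=
  IH _ _ Pm Qm.
  by move=> PQ; apply: neq; rewrite PQ ee'.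
exists w, (e :: S), f, f', P', Q'; split=> //=; first by rewrite ee'.
by rewrite ev eqxx.
Qed.

(** The edge is the first step of an undirected walk from [v] to another vertex, which exists once
    [n > 0]. *)
Lemma incident_edge v : (0 < n)%N -> exists e : edge G, src e = v \/ tgt e = v.
Proof.
move=> n0; pose u := if v == ord0 then ord_max else ord0 : 'I_n.+1.
have uv : u != v.
  rewrite /u; case: (v =P ord0) => [->|/eqP]; last by rewrite eq_sym.
  by rewrite -val_eqE /= -lt0n.
have /connectP[[_ /= uE|w p /= /andP[/existsP[e eP] _] _]] :=
  dgraph_connected G v u; first by rewrite uE eqxx in uv.
by exists e; case/orP: eP => /andP[/eqP ? /eqP ?]; [left|right].
Qed.

Lemma route_exists : (0 < n)%N -> exists p : seq (edge G), route p.
Proof.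
by move=> /(incident_edge ord0)[e _]; have [p rp _] := route_through e;
  exists p.
Qed.

End Paths.

(** * Continuous functions and connected sets *)

(** [V] is open and closed relative to [K]. It is applied below with [V] and [W] on opposite sides
    of curves, to confine a face to one side. *)
Lemma connected_sub_open (T : topologicalType) (K V W : set T) :
  connected K -> open V -> open W -> K `<=` V `|` W ->
  (forall t, V t -> W t -> False) -> K `&` V !=set0 -> K `<=` V.
Proof.
move=> cK oV oW KVW VW KV; suff <- : K `&` V = K by move=> t [].
apply: cK => //; first by exists V.
exists (~` W); first exact: open_closedC.
apply/seteqP; split=> t [Kt]; first by move=> Vt; split=> // Wt; exact:
  VW Vt Wt.
by move=> Wt; split=> //; case: (KVW _ Kt).
Qed.

Section RealLemmas.
Context (R : realType).
Implicit Types (f g : R -> R) (x y a b : R).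

(** Precomposing with the retraction of the line onto the segment turns continuity on the segment
    into continuity everywhere. *)
Lemma continuous_clamp (a b : R) (f : R -> R) : a <= b ->
  {within `[a, b], continuous f} ->
  continuous (fun x => f (Num.max a (Num.min b x))).
Proof.
move=> ab /subspace_continuousP cf x.
have clampP y : `[a, b]%classic (Num.max a (Num.min b y)).
  by rewrite /= in_itv /= le_max lexx /= ge_max ab ge_min lexx.
have cc : {for x, continuous (fun y => Num.max a (Num.min b y))}.
  apply: (@continuous_max _ _ (fun=> a) (fun y => Num.min b y)).
    exact: cvg_cst.
  by apply: (@continuous_min _ _ (fun=> b) idfun); [exact: cvg_cst|exact:
    cvg_id].
move=> A nA; have /cc := cf _ (clampP x) A nA.
by apply: (@filterS _ (nbhs x)) => y /=; apply; exact: clampP.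
Qed.

Lemma continuous_lt f g x : continuous f -> continuous g -> f x < g x ->
  exists2 d : R, 0 < d & forall y, `|x - y| < d -> f y < g y.
Proof.
move=> cf cg fg.
have cfg : {for x, continuous (fun y => g y - f y)}.
  by apply: continuousB; [exact: cg|exact: cf].
have /= := cfg _ (open_nbhs_nbhs (conj (@open_gt _ 0) _)).
rewrite /= subr_gt0 => /(_ fg) /nbhs_ballP[d d0 dP]; exists d => // y yd.
by have := dP y yd; rewrite /= subr_gt0.
Qed.

Lemma continuous_neq_lt f g a b x y : continuous f -> continuous g ->
  (forall t, a < t < b -> f t <> g t) -> a < x < b -> a < y < b ->
  f x < g x -> f y < g y.
Proof.
move=> cf cg fg axb ayb fgx; rewrite ltNge; apply/negP => gfy.
have cfg : continuous (fun t => g t - f t).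
  by move=> t; apply: continuousB; [exact: cg|exact: cf].
pose h t := g t - f t.
have [le_xy|lt_yx] := leP x y.
- have [||c] := @IVT _ h x y 0 le_xy; first exact: continuous_subspaceT.
    by rewrite /h ge_min le_max !subr_le0 !subr_ge0 gfy (ltW fgx) orbT.
  rewrite in_itv /= => /andP[xc cy] /eqP; rewrite /h subr_eq0 => /eqP gfc.
  by apply: (fg c) => //; lra.
- have [||c] := @IVT _ h y x 0 (ltW lt_yx); first exact: continuous_subspaceT.
    by rewrite /h ge_min le_max !subr_le0 !subr_ge0 gfy (ltW fgx) orbT.
  rewrite in_itv /= => /andP[xc cy] /eqP; rewrite /h subr_eq0 => /eqP gfc.
  by apply: (fg c) => //; lra.
Qed.

(** No listed point lies in []a, y]]. This provides vertical lines just to the right of a vertex and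
    heights just above a route. *)
Lemma avoid_right (s : seq R) a b : a < b ->
  exists y, [/\ a < y, y < b & forall z, z \in s -> a < z -> y < z].
Proof.
move=> ab; elim: s => [|z s [y [ay yb yP]]].
  by exists ((a + b) / 2); split=> //; lra.
exists (if a < z then Num.min y ((a + z) / 2) else y); case: (ltP a z) => az;
  last first.
  by split=> // z'; rewrite inE => /predU1P[->|/yP //]; rewrite ltNge az.
split.
- by rewrite lt_min ay /=; lra.
- by rewrite gt_min yb.
move=> z'; rewrite inE gt_min => /predU1P[-> _|/yP /[apply] -> //].
by apply/orP; right; lra.
Qed.

Lemma avoid_left (s : seq R) a b : a < b ->
  exists y, [/\ a < y, y < b & forall z, z \in s -> z < b -> z < y].
Proof.
move=> ab; have [|y [by' ya yP]] := @avoid_right (map -%R s) (- b) (- a).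
  by rewrite ltrN2.
exists (- y); split; [lra|lra|] => z zs zb.
have := yP (- z); rewrite map_f // => /(_ isT); lra.
Qed.

Lemma continuous_pair (f g : R -> R) :
  continuous f -> continuous g -> continuous (fun t => (f t, g t)).
Proof.
move=> cf cg t; exact: (@cvg_pair _ _ _ (nbhs t) (nbhs (f t)) (nbhs (g t)) _ _ _
  f g (cf t) (cg t)).
Qed.

Lemma continuous_affine a b : continuous (fun t : R => a + b * t).
Proof.
move=> t; apply: (@continuousD _ _ _ (fun=> a) (fun t => b * t)).
  exact: cvg_cst.
exact: mulrl_continuous.
Qed.

Lemma continuous_gap (f : R -> R) : continuous f ->
  continuous (fun z : R * R => z.2 - f z.1).
Proof.
move=> cf z; apply: (@continuousB _ _ _ snd (fun z => f z.1)).
  exact: cvg_snd.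
by apply: (@continuous_comp _ _ _ fst f); [exact: cvg_fst|exact: cf].
Qed.

Lemma open_above (f : R -> R) : continuous f ->
  open [set z : R * R | f z.1 < z.2].
Proof.
move=> cf; have -> : [set z : R * R | f z.1 < z.2] =
    (fun z : R * R => z.2 - f z.1) @^-1` [set t | 0 < t].
  by apply/seteqP; split=> z /=; rewrite subr_gt0.
by apply: open_comp (@open_gt _ 0) => z _; exact: continuous_gap.
Qed.

Lemma open_below (f : R -> R) : continuous f ->
  open [set z : R * R | z.2 < f z.1].
Proof.
move=> cf; have -> : [set z : R * R | z.2 < f z.1] =
    (fun z : R * R => z.2 - f z.1) @^-1` [set t | t < 0].
  by apply/seteqP; split=> z /=; rewrite subr_lt0.
by apply: open_comp (@open_lt _ 0) => z _; exact: continuous_gap.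
Qed.

Lemma open_fst (A : set R) : open A -> open [set z : R * R | A z.1].
Proof. by apply: open_comp => z _; exact: cvg_fst. Qed.

Lemma closed_ball_out (K : set (R * R)) z : closed K -> ~ K z ->
  exists2 r : R, 0 < r & forall z', `|z.1 - z'.1| < r -> `|z.2 - z'.2| < r ->
    ~ K z'.
Proof.
move=> cK Kz; have /nbhs_ballP[r r0 rP] : nbhs z (~` K).
  by apply: open_nbhs_nbhs; split=> //; exact: closed_openC.
by exists r => // z' z1 z2; apply: rP; split.
Qed.

Lemma between_dist (x0 r a b t : R) : `|x0 - a| < r -> `|x0 - b| < r ->
  Num.min a b <= t <= Num.max a b -> `|x0 - t| < r.
Proof.
rewrite !ltr_norml => /andP[a1 a2] /andP[b1 b2].
by case: (leP a b) => ab /andP[t1 t2]; lra.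
Qed.

Lemma between_itv (r a b t : R) : 0 < a < r -> 0 < b < r ->
  Num.min a b <= t <= Num.max a b -> 0 < t < r.
Proof.
by move=> /andP[a1 a2] /andP[b1 b2]; case: (leP a b) => ab /andP[t1 t2]; lra.
Qed.

End RealLemmas.

(** * Heights of routes, and coherence *)

Section Heights.
Context (R : realType) (n : nat) (G : dgraph n) (D : drawing R G).
Implicit Types (p q P Q S : seq (edge G)) (e : edge G) (u v w : 'I_n.+1).
Implicit Types (x y t : R).

Local Notation X := (abscissa D).
Local Notation L := (level D).
Local Notation h := (height D).

Definition on_edge x e := (X (src e) <= x) && (x <= X (tgt e)).
Definition over_edge x e := (X (src e) < x) && (x < X (tgt e)).

(* Continuous everywhere, and equal to the level outside of the interval of
   [e], where [height] is arbitrary. *)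
Definition clamped e x := h e (Num.max (X (src e)) (Num.min (X (tgt e)) x)).
Local Notation hh := clamped.

(* Each edge contributes 0 outside of its interval, so that on the interval of
   an edge [e] of [p] only the height of [e] remains. *)
Fixpoint path_height p x : R :=
  if p is e :: p' then path_height p' x + (hh e x - L) else L.
Local Notation ph := path_height.

Lemma abscissa_le u v : (u <= v)%N -> X u <= X v.
Proof.
rewrite leq_eqVlt => /orP[/eqP/val_inj -> //|/abscissa_lt uv]; exact/ltW/uv.
Qed.

Lemma abscissa_ltE u v : (X u < X v) = (u < v)%N.
Proof.
apply/idP/idP => [|/abscissa_lt uv]; last exact: uv.
rewrite ltNge ltnNge.
by apply: contra => /abscissa_le.
Qed.

Lemma edge_lt e : X (src e) < X (tgt e).
Proof. by rewrite abscissa_ltE src_lt_tgt. Qed.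

Lemma over_on x e : over_edge x e -> on_edge x e.
Proof. by move=> /andP[/ltW a /ltW b]; apply/andP. Qed.

Lemma clamped_on e x : on_edge x e -> hh e x = h e x.
Proof.
by move=> /andP[sx xt]; rewrite /hh (min_idPr xt) (max_idPr sx).
Qed.

Lemma clamped_left e x : x <= X (src e) -> hh e x = L.
Proof.
move=> xs; rewrite /hh min_r ?(le_trans xs) ?(ltW (edge_lt _)) //.
by rewrite max_l // height_src.
Qed.

Lemma clamped_right e x : X (tgt e) <= x -> hh e x = L.
Proof.
by move=> xt; rewrite /hh min_l // max_r ?(ltW (edge_lt _)) // height_tgt.
Qed.

Lemma clamped_continuous e : continuous (hh e).
Proof.
by apply: continuous_clamp; [exact/ltW/edge_lt|exact: height_continuous].
Qed.

Lemma ph_continuous p : continuous (ph p).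
Proof.
elim: p => [|e p IH] x /=; first exact: cvg_cst.
apply: (@continuousD _ _ _ (ph p) (fun x => hh e x - L)); first exact: IH.
apply: (@continuousB _ _ _ (hh e) (fun=> L)); last exact: cvg_cst.
exact: clamped_continuous.
Qed.

Lemma ph_cat p q x : ph (p ++ q) x = ph p x + (ph q x - L).
Proof. by elim: p => [|e p IH] /=; [|rewrite IH]; ring. Qed.

Lemma ph_left u p v x : dipath u p v -> x <= X u -> ph p x = L.
Proof.
elim: p u => [//|e p IH] u /= /andP[/eqP eu pv] xu.
rewrite (IH _ pv) ?clamped_left ?eu //; first by ring.
by rewrite (le_trans xu) // -eu ltW ?edge_lt.
Qed.

Lemma ph_right u p v x : dipath u p v -> X v <= x -> ph p x = L.
Proof.
elim: p u => [//|e p IH] u /= /andP[/eqP eu pv] vx.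
rewrite (IH _ pv) ?clamped_right //; first by ring.
by rewrite (le_trans _ vx) // abscissa_le // (dipath_le pv).
Qed.

Lemma ph_on u p v e x : dipath u p v -> e \in p -> on_edge x e ->
  ph p x = h e x.
Proof.
move=> pv ep xe; have [p1 [p2 [-> p1e p2e]]] := dipath_split pv ep.
have /andP[sx xt] := xe; rewrite ph_cat /= (ph_right p1e) // (ph_left p2e) //.
by rewrite clamped_on //; ring.
Qed.

(** At a vertex, the half-open interval selects the edge of the path that enters it. *)
Lemma edge_at_left u p v x : dipath u p v -> X u < x <= X v ->
  exists2 e, e \in p & X (src e) < x <= X (tgt e).
Proof.
elim: p u => [|e p IH] u /= => [/eqP ->|/andP[/eqP eu pv]] uxv; first lra.
have [xt|tx] := leP x (X (tgt e)).
  exists e; rewrite ?mem_head // eu; lra.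
have [|e' e'p xe'] := IH _ pv; first lra.
by exists e'; rewrite // inE e'p orbT.
Qed.

Lemma edge_at x P : route P -> X ord0 < x < X ord_max ->
  exists2 e, e \in P & on_edge x e.
Proof.
move=> rP xP; have [|e eP xe] := @edge_at_left _ _ _ x rP; first lra.
by exists e => //; rewrite /on_edge; lra.
Qed.

(** A vertical line at such an abscissa meets the edges only in interior points, whose heights are
    pairwise distinct when the drawing is crossing-free. *)
Definition generic x := forall v, x <> X v.

Lemma generic_over x e : generic x -> on_edge x e = over_edge x e.
Proof.
move=> gx; apply/idP/idP; last exact: over_on.
rewrite /on_edge /over_edge !le_eqVlt.
by move=> /andP[/predU1P[/esym/gx //|->] /predU1P[/gx //|->]].
Qed.

Lemma ph_neq_strip P x : route P -> ph P x != L -> X ord0 < x < X ord_max.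
Proof.
move=> rP; apply: contraR.
rewrite negb_and -!leNgt => /orP[?|?]; apply/eqP.
  exact: ph_left rP _.
exact: ph_right rP _.
Qed.

Lemma ph_lt_strip P Q x : route P -> route Q -> ph P x < ph Q x ->
  X ord0 < x < X ord_max.
Proof.
move=> rP rQ PQ; have [PL|] := eqVneq (ph P x) L; last exact: ph_neq_strip.
by apply: (ph_neq_strip rQ); rewrite -PL gt_eqF.
Qed.

(** * Coherent routes are those that do not cross *)

Section Planar.
Context (D_planar : crossing_free D).

Lemma meet_vertex e e' x : e <> e' -> on_edge x e -> on_edge x e' ->
  h e x = h e' x -> exists v, [/\ x = X v, v = src e \/ v = tgt e
    & v = src e' \/ v = tgt e'].
Proof.
move=> ee' xe xe' hx; have [v [[xv _] ve ve']] : exists v : 'I_n.+1,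
  [/\ (x, h e x) = point D v, v = src e \/ v = tgt e
    & v = src e' \/ v = tgt e'].
  by apply: (D_planar.2 _ _ _ ee'); split.
by exists v.
Qed.

Lemma over_neq e e' x : e <> e' -> over_edge x e -> on_edge x e' ->
  h e x <> h e' x.
Proof.
move=> ee' xe xe' hx; have [v [xv ve _]] := meet_vertex ee' (over_on xe) xe' hx.
by move: xe; rewrite /over_edge; case: ve => <-; rewrite xv ltxx ?andbF.
Qed.

Lemma over_vertex e v : over_edge (X v) e -> h e (X v) <> L.
Proof.
move=> ve hv; have [||] := D_planar.1 e v.
- by split=> //=; exact: over_on.
- by move=> ves; move: ve; rewrite /over_edge ves ltxx.
- by move=> ves; move: ve; rewrite /over_edge ves ltxx andbF.
Qed.

Lemma over_lt e e' x y a b : e <> e' ->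
  (forall t, a < t < b -> over_edge t e /\ over_edge t e') ->
  a < x < b -> a < y < b -> h e x < h e' x -> h e y < h e' y.
Proof.
move=> ee' abP xab yab.
have E f t : a < t < b -> f = e \/ f = e' -> h f t = hh f t.
  by move=> /abP[te te'] [->|->]; rewrite clamped_on //; exact: over_on.
rewrite !(E _ _ _ (or_introl erefl)) ?(E _ _ _ (or_intror erefl)) //.
apply: (continuous_neq_lt (@clamped_continuous e) (@clamped_continuous e') _
  xab yab).
move=> t abt; rewrite -(E e) -?(E e') //; [|by right|by left].
have [te te'] := abP _ abt; exact: over_neq (over_on te').
Qed.

Lemma ph_neq P Q : route P -> route Q -> P <> Q -> exists x, ph P x != ph Q x.
Proof.
move=> rP rQ PQ; have [w [S [e [e' [P' [Q' [PE QE ee' [ew e'w] Sw]]]]]]] :=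
  dipath_fork rP rQ PQ.
(* The two edges leave [w] together and cannot meet again before the nearer of their ends. *)
pose b := Num.min (X (tgt e)) (X (tgt e')).
have wb : X w < b by rewrite lt_min -{1}ew -e'w !edge_lt.
have [bt bt'] : b <= X (tgt e) /\ b <= X (tgt e') by rewrite !ge_min !lexx orbT.
exists ((X w + b) / 2).
have xe : over_edge ((X w + b) / 2) e by rewrite /over_edge ew; lra.
have xe' : over_edge ((X w + b) / 2) e' by rewrite /over_edge e'w; lra.
rewrite (ph_on rP (e := e)) ?(ph_on rQ (e := e')) ?over_on //.
- by apply/eqP/over_neq => //; exact: over_on.
- by rewrite QE mem_cat mem_head orbT.
- by rewrite PE mem_cat mem_head orbT.
Qed.

Definition noncrossing P Q :=
  (forall x, ph P x <= ph Q x) \/ (forall x, ph Q x <= ph P x).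

(** In the planar framing the smaller edge is the upper one, so precedence would put [P] strictly
    above [Q] just before the vertex where they merge. *)
Lemma le_not_prec_before P Q Pv Qv P' Q' : route P -> route Q ->
  P = Pv ++ P' -> Q = Qv ++ Q' -> (forall x, ph P x <= ph Q x) ->
  ~ prec_before (planar_framing D) Pv Qv.
Proof.
move=> rP rQ PE QE le_PQ [w [P1 [Q1 [S [e [e' [Pv_E QvE ee' [ew e'w] /=
  prec]]]]]]].
have eP : e \in P by rewrite PE Pv_E !mem_cat mem_rcons mem_head.
have eQ : e' \in Q by rewrite QE QvE !mem_cat mem_rcons mem_head.
near (X w)^'- => x.
have xw : x < X w by near: x; exact: nbhs_left_lt.
have xs : X (src e) < x by near: x; apply: nbhs_left_gt; rewrite -ew edge_lt.
have xs' : X (src e') < x by near: x; apply: nbhs_left_gt; rewrite -e'w edge_lt.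
have : h e' x < h e x by near: x.
have := le_PQ x; rewrite (ph_on rP eP) ?(ph_on rQ eQ); first lra.
  by rewrite /on_edge e'w; lra.
by rewrite /on_edge ew; lra.
Unshelve. all: end_near.
Qed.

Lemma le_not_prec_after P Q Pv Qv P' Q' : route P -> route Q ->
  P = P' ++ Pv -> Q = Q' ++ Qv -> (forall x, ph P x <= ph Q x) ->
  ~ prec_after (planar_framing D) Pv Qv.
Proof.
move=> rP rQ PE QE le_PQ [w [P1 [Q1 [S [e [e' [Pv_E QvE ee' [ew e'w] /=
  prec]]]]]]].
have eP : e \in P by rewrite PE Pv_E !mem_cat mem_head !orbT.
have eQ : e' \in Q by rewrite QE QvE !mem_cat mem_head !orbT.
near (X w)^'+ => x.
have xw : X w < x by near: x; exact: nbhs_right_gt.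
have xs : x < X (tgt e) by near: x; apply: nbhs_right_lt; rewrite -ew edge_lt.
have xs' : x < X (tgt e') by near: x; apply: nbhs_right_lt;
  rewrite -e'w edge_lt.
have : h e' x < h e x by near: x.
have := le_PQ x; rewrite (ph_on rP eP) ?(ph_on rQ eQ); first lra.
  by rewrite /on_edge e'w; lra.
by rewrite /on_edge ew; lra.
Unshelve. all: end_near.
Qed.

Lemma noncrossing_coherent P Q : route P -> route Q -> noncrossing P Q ->
  coherent (planar_framing D) P Q.
Proof.
move=> rP rQ cPQ v _ Pv vP Qv vQ [PE _ _] [QE _ _]; case: cPQ => le_PQ.
- move=> [[/(le_not_prec_before rP rQ PE QE le_PQ)] //|[_]].
  exact: (le_not_prec_after rP rQ PE QE).
- move=> [[_]|[/(le_not_prec_before rQ rP QE PE le_PQ)]] //.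
  exact: (le_not_prec_after rQ rP QE PE).
Qed.

(* The supremum [t0] of the points before [y] where [P] is strictly below [Q] is
   the abscissa of a vertex where the two routes merge, with [Q] on top; since
   [P] is not below [Q] between [t0] and [y], when they part again [P] is on
   top. *)
Lemma crossing_incoherent P Q x y : route P -> route Q ->
  ph P x < ph Q x -> ph Q y < ph P y -> x < y ->
  ~ coherent (planar_framing D) P Q.
Proof.
move=> rP rQ PQx QPy xy coh.
have xs := ph_lt_strip rP rQ PQx; have ys := ph_lt_strip rQ rP QPy.
pose A := [set t | t <= y /\ ph P t < ph Q t].
have Ax : A x by split=> //; exact: ltW.
have supA : has_sup A by split; [exists x|exists y => t []].
pose t0 := sup A.
have xt0 : x <= t0 by apply: ub_le_sup => //; case: supA.
have t0y : t0 <= y by apply: ge_sup => [|t []//]; exists x.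
have t0P t : t0 < t -> t <= y -> ph Q t <= ph P t.
  move=> t0t ty; rewrite leNgt; apply/negP => PQt.
  by have : t <= t0 by [apply: ub_le_sup => //; case: supA]; rewrite leNgt t0t.
(* Either strict inequality would persist near [t0]: [Q] below [P] contradicts that [A] comes
   arbitrarily close to [t0], and [P] below [Q] that [A] has no point beyond it. *)
have PQt0 : ph P t0 = ph Q t0.
  apply/eqP; rewrite eq_le; apply/andP; split; rewrite leNgt; apply/negP => lt0.
    have [d d0 dP] := continuous_lt (@ph_continuous Q) (@ph_continuous P) lt0.
    have [t [ty PQt] tt0] := sup_adherent d0 supA.
    have tle : t <= t0 by apply: ub_le_sup => //; case: supA.
    by have := dP t; rewrite ger0_norm ?subr_ge0 // => /(_ _);
      rewrite -/t0 in tt0; move: PQt; lra.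
  have [d d0 dP] := continuous_lt (@ph_continuous P) (@ph_continuous Q) lt0.
  have t0y' : t0 < y.
    by rewrite lt_neqAle t0y andbT; apply/eqP => ty; move: lt0 QPy; rewrite ty;
      lra.
  pose t := t0 + Num.min (d / 2) ((y - t0) / 2).
  have m0 : 0 < Num.min (d / 2) ((y - t0) / 2) by rewrite lt_min; lra.
  have md : Num.min (d / 2) ((y - t0) / 2) <= d / 2 by rewrite ge_min lexx.
  have my : Num.min (d / 2) ((y - t0) / 2) <= (y - t0) / 2 by rewrite ge_min
    lexx orbT.
  have : ph Q t <= ph P t by apply: t0P; rewrite /t; lra.
  rewrite leNgt dP // /t opprD addrA subrr add0r normrN gtr0_norm //; lra.
have [|e eP te] := @edge_at_left _ _ _ t0 rP; first lra.
have [|e' eQ te'] := @edge_at_left _ _ _ t0 rQ; first lra.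
pose a := Num.max (X (src e)) (X (src e')).
have at0 : a < t0 by rewrite gt_max; lra.
have [sa sa'] : X (src e) <= a /\ X (src e') <= a by rewrite !le_max !lexx orbT.
(* The heights agree at [t0], so [t0] is not in [A] and points of [A] approach it strictly from the
   left. *)
have [t [[ty PQt] at_ tt0]] : exists t, [/\ A t, a < t & t < t0].
  have [|t At] := sup_adherent (_ : 0 < t0 - a) supA; first by rewrite subr_gt0.
  rewrite -/t0 => tt0; exists t; split=> //; first lra.
  rewrite lt_neqAle ub_le_sup ?andbT //; last by case: supA.
  by apply/eqP => tE; case: At; rewrite tE -/t0 PQt0 ltxx.
have onP s : a < s <= t0 -> on_edge s e by rewrite /on_edge; lra.
have onQ s : a < s <= t0 -> on_edge s e' by rewrite /on_edge; lra.
have PE s : a < s <= t0 -> ph P s = h e s by move=> ?;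
  rewrite (ph_on rP eP) // onP.
have QE s : a < s <= t0 -> ph Q s = h e' s by move=> ?;
  rewrite (ph_on rQ eQ) // onQ.
have ee' : e <> e'.
  by move=> ee'; move: PQt; rewrite PE ?QE ?ee' ?ltxx; lra.
have t0a : a < t0 <= t0 by rewrite at0 lexx.
have [|v [t0v ve ve']] := meet_vertex ee' (onP t0 t0a) (onQ t0 t0a).
  by rewrite -PE // -QE.
have {ve}ev : tgt e = v by case: ve => // vs; move: te; rewrite -vs t0v ltxx.
have {ve'}e'v : tgt e' = v by case: ve' => // vs; move: te';
  rewrite -vs t0v ltxx.
have prec_in : fr_in (planar_framing D) v e' e.
  rewrite /= -t0v; near=> s.
  have sat : a < s < t0.
    by apply/andP; split; near: s; [exact: nbhs_left_gt|exact: nbhs_left_lt].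
  apply: (@over_lt e e' t s a t0) => //; last 2 first.
  - by rewrite at_.
  - by rewrite -PE -?QE //; lra.
  by move=> r ra; rewrite /over_edge ev e'v -t0v; split; lra.
have [P1 [P2 [PE' P1e P2e]]] := dipath_split rP eP.
have [Q1 [Q2 [QE' Q1e Q2e]]] := dipath_split rQ eQ.
rewrite ev in P2e; rewrite e'v in Q2e.
have P1v : dipath ord0 (rcons P1 e) v.
  by rewrite -cats1; apply/dipath_cat; exists (src e) => //=; rewrite ev !eqxx.
have Q1v : dipath ord0 (rcons Q1 e') v.
  by rewrite -cats1; apply/dipath_cat; exists (src e') => //=;
    rewrite e'v !eqxx.
rewrite -cat_rcons in PE'; rewrite -cat_rcons in QE'.
have vy : X v < y.
  by rewrite -t0v lt_neqAle t0y andbT; apply/eqP => tE; move: QPy;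
    rewrite -tE PQt0 ltxx.
have PQ2 : P2 <> Q2.
  move=> PQ2; move: QPy; rewrite PE' QE' !ph_cat PQ2.
  by rewrite (ph_right P1v) ?(ph_right Q1v) ?ltxx // ltW.
have [w [S [f [f' [P' [Q' [P2E Q2E ff' [fw f'w] Sw]]]]]]] :=
  dipath_fork P2e Q2e PQ2.
have vw : X v <= X w by rewrite abscissa_le // (dipath_le Sw).
(* If the routes parted only at or after [y], they would have equal heights at [y]. *)
have wy : X w < y.
  rewrite ltNge; apply/negP => yw; move: QPy.
  move: P2e; rewrite P2E => /dipath_cat[w' _ fP].
  have wE : w' = w by move: fP => /= /andP[/eqP <-].
  rewrite wE in fP.
  move: Q2e; rewrite Q2E => /dipath_cat[w2 _ fQ].
  have w2E : w2 = w by move: fQ => /= /andP[/eqP <-].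
  rewrite w2E in fQ.
  rewrite PE' QE' P2E Q2E !ph_cat (ph_right P1v) ?(ph_right Q1v) ?(ltW vy) //.
  by rewrite (ph_left fP) ?(ph_left fQ) ?ltxx.
have prec_out : fr_out (planar_framing D) w f f'.
  rewrite /=; near=> s.
  have ws : X w < s by near: s; exact: nbhs_right_gt.
  have sy : s < y by near: s; exact: nbhs_right_lt.
  have sf : s < X (tgt f) by near: s; apply: nbhs_right_lt; rewrite -fw edge_lt.
  have sf' : s < X (tgt f') by near: s; apply: nbhs_right_lt;
    rewrite -f'w edge_lt.
  have fs : over_edge s f by rewrite /over_edge fw; lra.
  have fs' : over_edge s f' by rewrite /over_edge f'w; lra.
  have := t0P s; rewrite t0v => /(_ _ (ltW sy)).
  rewrite (ph_on rP (e := f)) ?(ph_on rQ (e := f')) ?over_on //; last 2 first.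
  - by rewrite QE' Q2E !mem_cat mem_head !orbT.
  - by rewrite PE' P2E !mem_cat mem_head !orbT.
  move=> le_s; rewrite lt_neqAle le_s; last by lra.
  by rewrite andbT; apply/eqP => E; apply: (over_neq ff' fs (over_on fs')).
have iv : inner v.
  by rewrite /inner; apply/andP; split; apply/eqP => vE; move: xs ys xt0 vy;
    rewrite t0v vE; lra.
apply: (coh v iv (rcons P1 e) P2 (rcons Q1 e') Q2) => //; right; split.
  exists v, Q1, P1, [::], e', e; rewrite !cats0; split=> //.
  by move=> E; apply: ee'.
by exists w, P', Q', S, f, f'; split.
Unshelve. all: end_near.
Qed.

Lemma coherent_sym P Q : coherent (planar_framing D) P Q ->
  coherent (planar_framing D) Q P.
Proof.
move=> coh v iv Pv vP Qv vQ sP sQ bad.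
by apply: (coh v iv _ _ _ _ sQ sP); case: bad; [right|left].
Qed.

Lemma coherent_noncrossing P Q : route P -> route Q ->
  coherent (planar_framing D) P Q -> noncrossing P Q.
Proof.
move=> rP rQ coh; apply: contrapT =>
  /not_orP[/existsNP[x /negP] + /existsNP[y /negP]].
rewrite -!ltNge => QPx PQy.
have [xy|yx|xy] := ltgtP x y.
- exact: (crossing_incoherent rQ rP QPx PQy xy (coherent_sym coh)).
- exact: (crossing_incoherent rP rQ PQy QPx yx coh).
- by move: QPx PQy; rewrite xy; lra.
Qed.

End Planar.
End Heights.

(** * Faces *)

Section Faces.
Context (R : realType) (n : nat) (G : dgraph n) (D : drawing R G).
Implicit Types (p q P Q S : seq (edge G)) (e f : edge G) (u v w : 'I_n.+1).
Implicit Types (x y t s : R) (F : set (R * R)) (z : R * R).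

Local Notation X := (abscissa D).
Local Notation h := (height D).
Local Notation hh := (clamped D).
Local Notation on := (on_edge D).
Local Notation comp := (connected_component (~` support D)).

(** Boundedness is left out because the region next to an edge can be the unbounded one. *)
Definition face F := exists2 z, ~ support D z & F = comp z.

Lemma bounded_face_face F : bounded_face D F -> face F.
Proof. by case. Qed.

Lemma face_comp F z : face F -> F z -> F = comp z.
Proof. by move=> [z0 _ ->] /same_connected_component. Qed.

Lemma face_out F z : face F -> F z -> ~ support D z.
Proof. by move=> [z0 _ ->] /connected_component_sub. Qed.

Lemma face_eq F F' z : face F -> face F' -> F z -> F' z -> F = F'.
Proof. by move=> fF fF' /(face_comp fF) -> /(face_comp fF') ->. Qed.

Lemma comp_face z : ~ support D z -> face (comp z).
Proof. by exists z. Qed.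

Lemma comp_self z : ~ support D z -> comp z z.
Proof. exact: connected_component_refl. Qed.

(** The image of the segment is connected and avoids the support. The minimum and maximum allow [a]
    and [b] in either order. *)
Lemma face_path F (g : R -> R * R) a b : face F -> continuous g ->
  (forall t, Num.min a b <= t <= Num.max a b -> ~ support D (g t)) ->
  F (g a) -> F (g b).
Proof.
move=> fF cg out Fa; rewrite (face_comp fF Fa).
set c := Num.min a b; set d := Num.max a b.
apply: (@connected_component_max _ _ (g @` `[c, d])).
- by exists a => //=; rewrite in_itv /= /c /d ge_min le_max lexx.
- by move=> _ [t /= + <-]; rewrite in_itv /= => /out.
- apply: connected_continuous_connected; first exact: segment_connected.
  exact: continuous_subspaceT.
- by exists b => //=; rewrite in_itv /= /c /d ge_min le_max lexx !orbT.
Qed.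

Lemma face_vertical F x a b : face F ->
  (forall t, Num.min a b <= t <= Num.max a b -> ~ support D (x, t)) ->
  F (x, a) -> F (x, b).
Proof.
move=> fF; apply: (face_path (g := fun t => (x, t))) => //.
by apply: continuous_pair => t; [exact: cvg_cst|exact: cvg_id].
Qed.

Lemma face_horizontal F y a b : face F ->
  (forall t, Num.min a b <= t <= Num.max a b -> ~ support D (t, y)) ->
  F (a, y) -> F (b, y).
Proof.
move=> fF; apply: (face_path (g := fun t => (t, y))) => //.
by apply: continuous_pair => t; [exact: cvg_id|exact: cvg_cst].
Qed.

Lemma curve_closed e : closed (curve D e).
Proof.
rewrite -[curve D e]setCK; apply: open_closedC.
(* The complement is the union of four open sets: left of, right of, above and below the curve. *)
have -> : ~` curve D e = [set z : R * R | z.1 < X (src e)]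
   `|` [set z | X (tgt e) < z.1] `|` [set z | hh e z.1 < z.2]
   `|` [set z | z.2 < hh e z.1].
  apply/seteqP; split=> z /=.
    move=> nc; have [xs|xs] := ltP z.1 (X (src e)); first by do 3 left.
    have [xt|xt] := ltP (X (tgt e)) z.1; first by do 2 left; right.
    have ze : on z.1 e by rewrite /on_edge xs xt.
    have [||E] := ltgtP z.2 (hh e z.1); [by right|by left; right|].
    by case: nc; split=> //; rewrite -clamped_on.
  rewrite /curve /= => zP [/[dup] ze /andP[sz zt] zh].
  by move: zP; rewrite clamped_on // zh ltxx; case=> [[[]|]|] //; lra.
apply: openU; last exact/open_below/clamped_continuous.
apply: openU; last exact/open_above/clamped_continuous.
by apply: openU; [exact: open_fst (@open_lt _ _)|exact:
  open_fst (@open_gt _ _)].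
Qed.

(** It is used with all edges, and with all edges but one in order to isolate the remaining one. *)
Lemma support_closed_with (A : set (edge G)) :
  closed (\bigcup_(e in A) curve D e `|` range (point D)).
Proof.
apply: closedU.
  by apply: closed_bigcup => [|e _]; [exact: finite_finset|exact: curve_closed].
apply: compact_closed; first exact: norm_hausdorff.
exact/finite_compact/finite_image/finite_finset.
Qed.

(* For [n = 0] the support is a vertex on no edge. *)
Lemma supportP z : (0 < n)%N ->
  support D z <-> exists2 e, on z.1 e & z.2 = h e z.1.
Proof.
move=> n0; split=> [[[e _ [ze zh]]|[v _ <-]]|[e ze zh]]; first by exists e.
  have [e ev] := incident_edge G v n0; exists e => /=.
    by case: ev => <-; rewrite /on_edge lexx ?andbT ltW ?edge_lt.
  by case: ev => <-; rewrite ?height_src ?height_tgt.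
by left; exists e.
Qed.

Lemma unbounded_ray z c : ~ support D z -> `|c| = 1 ->
  (forall t, 0 <= t -> ~ support D (z.1, z.2 + c * t)) ->
  ~ bounded_set (comp z).
Proof.
move=> zS c1 out [M [_ MP]].
have {}MP z' : comp z z' -> `|z'| <= M + 1 by apply: MP; rewrite ltrDl.
(* A vertical move of this length reaches a point of norm greater than [M + 1]. *)
pose b := `|z.2| + `|M| + 2.
have b0 : 0 <= b by rewrite /b !addr_ge0.
have : comp z (z.1, z.2 + c * b).
  apply: (@face_path (comp z) (fun t => (z.1, z.2 + c * t)) 0 b).
  - exact: comp_face.
  - apply: continuous_pair; last exact: continuous_affine.
    by move=> t; exact: cvg_cst.
  - by move=> t; rewrite min_l // => /andP[t0 _]; exact: out.
  - by rewrite mulr0 addr0 -surjective_pairing; exact: comp_self.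
move=> /MP; rewrite prod_normE /= ge_max => /andP[_].
have := ler_normB (z.2 + c * b) z.2; rewrite addrC addKr normrM c1 mul1r.
by rewrite ger0_norm // /b; have := ler_norm M; lra.
Qed.

End Faces.

(** * Bounded faces and their position relative to routes *)

Section FacesAndRoutes.
Context (R : realType) (n : nat) (G : dgraph n) (D : drawing R G).
Implicit Types (p q P Q S : seq (edge G)) (e f : edge G) (u v w : 'I_n.+1).
Implicit Types (x y t s : R) (F : set (R * R)) (z : R * R).

Local Notation X := (abscissa D).
Local Notation L := (level D).
Local Notation h := (height D).
Local Notation hh := (clamped D).
Local Notation ph := (path_height D).
Local Notation on := (on_edge D).
Local Notation comp := (connected_component (~` support D)).

(** Without an edge below or without an edge above, a vertical ray from [z] escapes to infinity
    inside its face. *)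
Lemma bounded_between z : ~ support D z -> bounded_set (comp z) ->
  exists e e', [/\ on z.1 e, on z.1 e', h e z.1 < z.2 & z.2 < h e' z.1].
Proof.
move=> zS; apply: contraPP => no_between.
(* For [n = 0] the support is a single point, and the ray pointing away from its level avoids it. *)
have [n0|n0] := posnP n.
  have no_edge (e : edge G) : e <> e.
    by have := src_lt_tgt e; have := ltn_ord (tgt e); lia.
  have supp t : support D (z.1, t) -> t = L /\ support D (z.1, L).
    by move=> [[e]|[v _ [<- <-]]]; [case: (no_edge e)|split=> //; right;
      exists v].
  have zE : z = (z.1, z.2) by rewrite -surjective_pairing.
  have [zL'|zL'] := leP L z.2.
    apply: (@unbounded_ray _ _ _ _ z 1) => //; first by rewrite normr1.
    move=> t t0 /supp[tL sL]; apply: zS; rewrite zE.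
    by have -> : z.2 = L by lra.
  apply: (@unbounded_ray _ _ _ _ z (-1)) => //; first by rewrite normrN1.
  by move=> t t0 /supp[tL _]; move: zL' t0 tL; clear; lra.
have neq e : on z.1 e -> h e z.1 != z.2.
  by move=> ze; apply/eqP => hz; apply: zS; apply/supportP => //; exists e.
have [[e ze hz]|no_below] := pselect (exists2 e, on z.1 e & h e z.1 < z.2).
  apply: (@unbounded_ray _ _ _ _ z 1) => //; first by rewrite normr1.
  move=> t t0 /supportP -/(_ n0)[e' /= ze' hz']; apply: no_between.
  exists e, e'; split=> //; rewrite lt_neqAle eq_sym neq //= -hz'; lra.
apply: (@unbounded_ray _ _ _ _ z (-1)) => //; first by rewrite normrN1.
move=> t t0 /supportP -/(_ n0)[e' /= ze' hz']; apply: no_below.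
by exists e' => //; rewrite lt_neqAle neq //= -hz'; lra.
Qed.

Lemma ph_bounded p a b : exists M, forall x, a <= x <= b -> `|ph p x| <= M.
Proof.
have : compact (ph p @` `[a, b]).
  apply: continuous_compact; last exact: segment_compact.
  exact/continuous_subspaceT/ph_continuous.
move=> /compact_bounded[M [_ MP]]; exists (M + 1) => x xab.
by apply: (MP (M + 1)); [rewrite ltrDl|exists x => //=; rewrite in_itv].
Qed.

Lemma route_graph P x : route P -> X ord0 < x < X ord_max -> support D (x,
  ph P x).
Proof.
move=> rP xs; have [e eP xe] := edge_at rP xs.
by left; exists e => //; split=> //=; rewrite (ph_on rP eP).
Qed.

(** Extend the two edges to routes [P] and [Q]. The face cannot leave the region above [P] and below
    [Q], which is bounded because routes are at the level outside of the strip. *)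
Lemma between_bounded z e e' : ~ support D z -> on z.1 e -> on z.1 e' ->
  h e z.1 < z.2 -> z.2 < h e' z.1 -> bounded_face D (comp z).
Proof.
move=> zS ze ze' ez ze'2; split; first by exists z.
have [P rP eP] := route_through e; have [Q rQ eQ] := route_through e'.
pose V := [set z : R * R | ph P z.1 < z.2] `&` [set z | z.2 < ph Q z.1].
pose W := [set z : R * R | z.2 < ph P z.1] `|` [set z | ph Q z.1 < z.2]
  `|` [set z | z.1 < X ord0] `|` [set z | X ord_max < z.1].
have strip (z' : R * R) : V z' -> X ord0 < z'.1 < X ord_max.
  by case=> a b; exact: (ph_lt_strip rP rQ (lt_trans a b)).
have sub : comp z `<=` V.
  apply: (@connected_sub_open _ _ V W).
  - exact: component_connected.
  - by apply: openI; [apply: open_above|apply: open_below]; exact: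
      ph_continuous.
  - apply: openU; last exact: open_fst (@open_gt _ _).
    apply: openU; last exact: open_fst (@open_lt _ _).
    by apply: openU; [apply: open_below|apply: open_above]; exact:
      ph_continuous.
  - move=> z' /connected_component_sub z'S.
    apply: contrapT => /not_orP[nV] /not_orP[/not_orP[/not_orP[nP nQ] n1] n2].
    have {}nP : ph P z'.1 <= z'.2 by rewrite leNgt; apply/negP.
    have {}nQ : z'.2 <= ph Q z'.1 by rewrite leNgt; apply/negP.
    have {}n1 : X ord0 <= z'.1 by rewrite leNgt; apply/negP.
    have {}n2 : z'.1 <= X ord_max by rewrite leNgt; apply/negP.
    have z'E : z' = (z'.1, z'.2) by rewrite -surjective_pairing.
    (* At both ends of the strip the region is pinched to the source or the sink, which belongs to
       the support. *)
    have [E0|N0] := eqVneq z'.1 (X ord0).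
      apply: z'S; right; exists ord0 => //; rewrite z'E /point E0.
      move: nP nQ; rewrite (ph_left rP) ?(ph_left rQ) ?E0 // => ? ?.
      by congr pair; lra.
    have [E1|N1] := eqVneq z'.1 (X ord_max).
      apply: z'S; right; exists ord_max => //; rewrite z'E /point E1.
      move: nP nQ; rewrite (ph_right rP) ?(ph_right rQ) ?E1 // => ? ?.
      by congr pair; lra.
    have st : X ord0 < z'.1 < X ord_max by rewrite !lt_neqAle n1 n2 eq_sym N0
      N1.
    apply: nV; split; rewrite /= lt_neqAle ?nP ?nQ andbT; apply/eqP => E;
      apply: z'S.
      by rewrite z'E -E; exact: route_graph.
    by rewrite z'E E; exact: route_graph.
  - move=> z' /[dup] /strip st [/= a b]; rewrite /W /=; lra.
  - exists z; split; first exact: connected_component_refl.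
    by split=> /=; rewrite ?(ph_on rP eP) ?(ph_on rQ eQ).
have [M MP] := ph_bounded P (X ord0) (X ord_max).
have [N NP] := ph_bounded Q (X ord0) (X ord_max).
exists (`|M| + `|N| + `|X ord0| + `|X ord_max|); split; first exact: num_real.
move=> K ltK z' /sub /[dup] /strip st [/= Pz zQ].
have st' : X ord0 <= z'.1 <= X ord_max by lra.
have {}MP := MP _ st'; have {}NP := NP _ st'.
have aM := ler_norm M; have aN := ler_norm N.
have a0 := ler_norm (- X ord0); have a1 := ler_norm (X ord_max).
rewrite normrN in a0.
have := ler_norm (- ph P z'.1); have := ler_norm (ph Q z'.1);
  rewrite normrN => b1 b0.
have c0 := normr_ge0 M; have c1 := normr_ge0 N.
have c2 := normr_ge0 (X ord0); have c3 := normr_ge0 (X ord_max).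
rewrite prod_normE /= ge_max; apply/andP; split; apply/ler_normlP; split; lra.
Qed.

Lemma face_strip F z : bounded_face D F -> F z -> X ord0 < z.1 < X ord_max.
Proof.
move=> bF Fz; have fF := bounded_face_face bF.
have [|e [e' [ze ze' ez ze'2]]] := bounded_between (face_out fF Fz).
  by case: bF => _; rewrite (face_comp fF Fz).
have [P rP eP] := route_through e; have [Q rQ eQ] := route_through e'.
apply: (ph_lt_strip rP rQ).
by rewrite (ph_on rP eP) // (ph_on rQ eQ) // (lt_trans ez).
Qed.

Lemma face_connected F : face D F -> connected F.
Proof. by move=> [z _ ->]; exact: component_connected. Qed.

(** A bounded face is connected, stays in the strip between source and sink, and misses the graph of
    the route. *)
Lemma face_side F P z z' : bounded_face D F -> route P -> F z -> F z' ->
  z.2 < ph P z.1 -> z'.2 < ph P z'.1.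
Proof.
move=> bF rP Fz Fz' zP; have fF := bounded_face_face bF.
suff sub : F `<=` [set z : R * R | z.2 < ph P z.1] by exact: (sub z').
apply: (@connected_sub_open _ _ _ [set z : R * R | ph P z.1 < z.2]).
- exact: face_connected.
- exact/open_below/ph_continuous.
- exact/open_above/ph_continuous.
- move=> y Fy; have [|y2|E] := ltgtP y.2 (ph P y.1); [by left|by right|].
  case: (face_out fF Fy); rewrite [y]surjective_pairing E.
  exact: route_graph (face_strip bF Fy).
- by move=> y /= a b; lra.
- by exists z.
Qed.

(** By [face_side], a single point of the face decides. *)
Lemma below_routeE F P z : bounded_face D F -> route P -> F z ->
  below_route D F P <-> z.2 < ph P z.1.
Proof.
move=> bF rP Fz; split=> [/(_ z Fz)[e eP [ze zh]]|zP z' Fz'].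
  by rewrite (ph_on rP eP).
have [e eP xe] := edge_at rP (face_strip bF Fz'); exists e => //; split=> //.
by rewrite -(ph_on rP eP) //; exact: (face_side bF rP Fz Fz').
Qed.

(** The face is that of a point on the vertical line at [x], just above [P] and off every edge; the
    level is in the list so as to avoid the vertices too. *)
Lemma lt_face P Q x : route P -> route Q -> ph P x < ph Q x ->
  exists F, [/\ bounded_face D F, below_route D F Q & ~ below_route D F P].
Proof.
move=> rP rQ PQ; have xs := ph_lt_strip rP rQ PQ.
have [y [Py yQ yP]] := avoid_right (L :: [seq hh e x | e <- enum (edge G)]) PQ.
have out : ~ support D (x, y).
  move=> [[e _ [/= xe yE]]|[v _ [_ yE]]].
    have : hh e x \in L :: [seq hh e x | e <- enum (edge G)].
      by rewrite inE; apply/orP; right; apply/mapP; exists e; rewrite ?mem_enum.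
    by move=> /yP; rewrite clamped_on // -yE ltxx => /(_ Py).
  by have := yP L; rewrite mem_head yE ltxx => /(_ isT Py).
have [e eP xe] := edge_at rP xs; have [e' eQ xe'] := edge_at rQ xs.
have bF : bounded_face D (comp (x, y)).
  by apply: (between_bounded out xe xe');
    rewrite -?(ph_on rP eP) -?(ph_on rQ eQ).
have Fxy : comp (x, y) (x, y) by exact: connected_component_refl.
exists (comp (x, y)); split=> //; first by apply/(below_routeE bF rQ Fxy).
by move=> /(below_routeE bF rP Fxy) /=; lra.
Qed.

Lemma le_below F P Q : bounded_face D F -> route P -> route Q ->
  (forall x, ph P x <= ph Q x) -> below_route D F P -> below_route D F Q.
Proof.
move=> /[dup] bF [[z zS FE] _] rP rQ PQ.
have Fz : F z by rewrite FE; exact: connected_component_refl.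
move=> /(below_routeE bF rP Fz) zP; apply/(below_routeE bF rQ Fz).
exact: lt_le_trans (PQ _).
Qed.

Lemma adj_below F F' P : route P -> face_adj D F F' ->
  below_route D F' P -> below_route D F P.
Proof.
move=> rP [bF bF' [e sep]] FP.
have := sep ((X (src e) + X (tgt e)) / 2).
set x := _ / 2; have := edge_lt D e => st /(_ _) nF.
near (0 : R)^'+ => d.
have [Fd F'd] : F (x, h e x - d) /\ F' (x, h e x + d).
  by near: d; apply: nF; rewrite /x; lra.
have d0 : 0 < d by near: d; exact: nbhs_right_gt.
apply/(below_routeE bF rP Fd) => /=.
by move: FP => /(below_routeE bF' rP F'd) /=; lra.
Unshelve. all: end_near.
Qed.

(** Any route through the separating edge will do. *)
Lemma adj_separated F F' : face_adj D F F' ->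
  exists P, [/\ route P, below_route D F P & ~ below_route D F' P].
Proof.
move=> [bF bF' [e sep]]; have [P rP eP] := route_through e.
have := sep ((X (src e) + X (tgt e)) / 2).
set x := _ / 2; have := edge_lt D e => st /(_ _) nF.
have xe : on x e by rewrite /on_edge /x; lra.
near (0 : R)^'+ => d.
have [Fd F'd] : F (x, h e x - d) /\ F' (x, h e x + d).
  by near: d; apply: nF; rewrite /x; lra.
have d0 : 0 < d by near: d; exact: nbhs_right_gt.
exists P; split=> //; first by apply/(below_routeE bF rP Fd);
  rewrite /= (ph_on rP eP) //; lra.
by move=> /(below_routeE bF' rP F'd); rewrite /= (ph_on rP eP) //; lra.
Unshelve. all: end_near.
Qed.

End FacesAndRoutes.

(** * The faces on both sides of an edge *)

Section SideFaces.
Context (R : realType) (n : nat) (G : dgraph n) (D : drawing R G).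
Context (D_planar : crossing_free D).
Implicit Types (p q P Q S : seq (edge G)) (e f : edge G) (u v w : 'I_n.+1).
Implicit Types (x y t s : R) (F : set (R * R)) (z : R * R).

Local Notation X := (abscissa D).
Local Notation h := (height D).
Local Notation hh := (clamped D).
Local Notation over := (over_edge D).
Local Notation comp := (connected_component (~` support D)).

(** The rest of the support is closed and misses the point of [e] at [x0], hence misses a
    neighbourhood of it. *)
Lemma edge_tube e x0 : over x0 e -> exists2 r : R, 0 < r &
  forall x d, `|x0 - x| < r -> 0 < `|d| < r ->
    over x e /\ ~ support D (x, h e x + d).
Proof.
move=> ex0; pose K :=
  \bigcup_(f in [set f | f <> e]) curve D f `|` range (point D).
have [|r r0 rP] := @closed_ball_out _ K (x0,
  h e x0) (@support_closed_with _ _ _ D _).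
  move=> [[f fe [/= xf hf]]|[v _ [vx hv]]].
    by apply: (over_neq D_planar _ ex0 xf hf) => ef; apply: fe.
  by rewrite -vx in ex0 hv; exact: (over_vertex D_planar ex0 (esym hv)).
have cc (a : R) : continuous (fun _ : R => a) by move=> ?; exact: cvg_cst.
have [|d1 d10 d1P] := @continuous_lt _ (hh e) (fun=> hh e x0 + r / 2) x0
  (@clamped_continuous _ _ _ _ e) (cc _); first lra.
have [|d2 d20 d2P] := @continuous_lt _ (fun=> hh e x0 - r / 2) (hh e) x0
  (cc _) (@clamped_continuous _ _ _ _ e); first lra.
have /andP[sx0 x0t] := ex0.
(* [d1] and [d2] keep [e] within [r / 2] of its height at [x0], another [r / 2] is left for [d], and
   the last two terms keep [x] over [e]. *)
pose m := Num.min (Num.min d1 d2) (Num.min (r / 2) (Num.min (x0 - X (src e)) (X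
  (tgt e) - x0))).
have : m <= m by [].
rewrite {2}/m !le_min => /andP[/andP[md1 md2] /and3P[mr ms mt]].
exists m; first by rewrite /m !lt_min; lra.
move=> x d xm /andP[d0 dm].
have xe : over x e.
  by move: (xm); rewrite ltr_norml /over_edge => /andP[? ?]; lra.
have h1 := d1P x (lt_le_trans xm md1); have h2 := d2P x (lt_le_trans xm md2).
rewrite !clamped_on ?over_on // in h1 h2.
split=> // -[[f _ [/= xf hf]]|[v _ vx]].
  have [fe|fe] := pselect (f = e).
    by move: hf d0; rewrite fe => /eqP;
      rewrite -subr_eq0 addrAC subrr add0r => /eqP ->; rewrite normr0 ltxx.
  apply: (rP (x, h e x + d)) => /=; last by left; exists f.
    by lra.
  by move: dm; rewrite !ltr_norml => /andP[? ?]; lra.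
apply: (rP (x, h e x + d)) => /=; last by right; exists v.
  by lra.
by move: dm; rewrite !ltr_norml => /andP[? ?]; lra.
Qed.

(** Inside the tube, follow a vertical translate of [e] from [x] to [x'], then move vertically. The
    sign [c] chooses the side. *)
Lemma side_constant e x0 c : over x0 e -> `|c| = 1 -> exists2 r : R, 0 < r &
  forall F x x' d d', face D F -> `|x0 - x| < r -> `|x0 - x'| < r ->
    0 < d < r -> 0 < d' < r -> F (x, h e x + c * d) -> F (x', h e x' + c * d').
Proof.
move=> ex0 c1; have [r r0 rP] := edge_tube ex0; exists r => //.
have cP d : 0 < d < r -> 0 < `|c * d| < r.
  by move=> dr; rewrite normrM c1 mul1r gtr0_norm; lra.
have hhE x d : `|x0 - x| < r -> 0 < d < r -> h e x = hh e x.
  by move=> xr /cP /(rP _ _ xr)[/over_on xe _]; rewrite clamped_on.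
move=> F x x' d d' fF xr x'r dr d'r Fx.
have : F (x', h e x' + c * d).
  rewrite (hhE x' d) //.
  apply: (@face_path _ _ _ D F (fun t => (t, hh e t + c * d)) x x') => //.
  - apply: (@continuous_pair _ idfun (fun t => hh e t + c * d)) => t.
      exact: cvg_id.
    apply: (@continuousD _ _ _ (hh e) (fun=> c * d)); last exact: cvg_cst.
    exact: clamped_continuous.
  - move=> t /(between_dist xr x'r) tr; rewrite -(hhE t d) //.
    by have [] := rP t (c * d) tr (cP _ dr).
  - by rewrite -(hhE x d).
apply: (@face_path _ _ _ D F (fun t => (x', h e x' + c * t)) d d') => //.
  apply: (@continuous_pair _ (fun=> x') (fun t => h e x' + c * t)); last exact:
    continuous_affine.
  by move=> t; exact: cvg_cst.
by move=> t /(between_itv dr d'r) /cP tr; have [] := rP x' (c * t) x'r tr.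
Qed.

(** The abscissae at which [F] borders [e] on the given side, and those at which it does not, form
    two open sets by [side_constant]; the open interval of [e] is connected. *)
Lemma side_face_exists e c : `|c| = 1 -> exists F, face D F /\
  forall x, over x e -> \forall d \near 0^'+, F (x, h e x + c * d).
Proof.
move=> c1; have st := edge_lt D e.
pose m := (X (src e) + X (tgt e)) / 2.
have em : over m e by rewrite /over_edge /m; lra.
have near_lt (r : R) (A : set R) : 0 < r -> (forall d, 0 < d < r -> A d) ->
    \forall d \near 0^'+, A d.
  move=> r0 AP; near=> d; apply: AP; apply/andP; split; near: d.
    exact: nbhs_right_gt.
  exact: nbhs_right_lt.
have near_ex (r : R) (A : set R) : 0 < r -> (\forall d \near 0^'+, A d) ->
    exists2 d : R, 0 < d < r & A d.
  move=> r0 nA; near (0 : R)^'+ => d; exists d; last by near: d.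
  by apply/andP; split; near: d; [exact: nbhs_right_gt|exact: nbhs_right_lt].
have [r0 r00 r0P] := side_constant em c1.
have [r1 r10 r1P] := edge_tube em.
pose d0 := Num.min r0 r1 / 2.
have min0 : 0 < Num.min r0 r1 by rewrite lt_min r00 r10.
have [d0r0 d0r1] : Num.min r0 r1 <= r0 /\ Num.min r0 r1 <= r1.
  by rewrite !ge_min !lexx orbT.
have out : ~ support D (m, h e m + c * d0).
  have [||//] := r1P m (c * d0); first by rewrite subrr normr0.
  by rewrite normrM c1 mul1r gtr0_norm /d0; lra.
pose F := comp (m, h e m + c * d0).
have fF : face D F by exact: comp_face.
exists F; split=> //.
pose good x := \forall d \near 0^'+, F (x, h e x + c * d).
have local x : over x e -> exists2 r : R, 0 < r & forall x1 x2,
    `|x - x1| < r -> `|x - x2| < r -> good x1 -> good x2.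
  move=> ex; have [r rpos rP] := side_constant ex c1;
    exists r => // x1 x2 x1r x2r.
  move=> /(near_ex _ _ rpos)[d dr Fd]; apply: (near_lt r) => // d' d'r.
  exact: rP Fd.
pose V := [set x | over x e /\ good x]; pose W :=
  [set x | over x e /\ ~ good x].
have over_near x : over x e -> exists2 r :
  R, 0 < r & forall y, `|x - y| < r -> over y e.
  move=> /andP[sx xt]; exists (Num.min (x - X (src e)) (X (tgt e) - x)).
    by rewrite lt_min !subr_gt0 sx.
  by move=> y; rewrite lt_min !ltr_norml /over_edge =>
    /andP[/andP[? ?] /andP[? ?]]; lra.
have openP (A : set R) : (forall x, A x -> exists2 r : R, 0 < r &
    forall y, `|x - y| < r -> A y) -> open A.
  move=> AP; rewrite openE => x /AP[r rpos rP]; apply/nbhs_ballP.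
  by exists r => // y; exact: rP.
have oVW (b : bool) : open [set x | over x e /\ (if b then good x else ~ good
  x)].
  apply: openP => x [ex gx]; have [r1' r1p r1'P] := local x ex.
  have [r2 r2p r2P] := over_near x ex.
  exists (Num.min r1' r2); first by rewrite lt_min r1p.
  move=> y; rewrite lt_min => /andP[y1 y2]; split; first exact: r2P.
  have xx : `|x - x| < r1' by rewrite subrr normr0.
  by case: (b) gx => [|ngx gy]; [exact: r1'P|apply: ngx; exact: r1'P gy].
have sub : `]X (src e), X (tgt e)[%classic `<=` V.
  apply: (@connected_sub_open _ _ V W).
  - exact/connected_intervalP/interval_is_interval.
  - exact: (oVW true).
  - exact: (oVW false).
  - move=> x /=; rewrite in_itv /= => ex.
    by have [gx|gx] := pselect (good x); [left|right].
  - by move=> x [_ gx] [].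
  - exists m; split; first by rewrite /= in_itv.
    split=> //; apply: (near_lt r0) => // d dr.
    apply: (r0P F m m d0 d) => //; rewrite ?subrr ?normr0 //;
      first by rewrite /d0; lra.
    exact: connected_component_refl.
by move=> x ex; have [|] := sub x; first by rewrite /= in_itv.
Unshelve. all: end_near.
Qed.

(* The face just above [e] for [c = 1], and just below [e] for [c = -1]. *)
Definition side_face c e : set (R * R) :=
  xget set0 [set F | face D F /\
    forall x, over x e -> \forall d \near 0^'+, F (x, h e x + c * d)].

Local Notation fa := (side_face 1).
Local Notation fb := (side_face (-1)).

Lemma side_faceP c e : `|c| = 1 -> face D (side_face c e) /\
  forall x, over x e -> \forall d \near 0^'+, side_face c e (x, h e x + c * d).
Proof.
by move=> /(side_face_exists e)/(xgetPex set0).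
Qed.

Lemma above_face e : face D (fa e).
Proof. by have [] := @side_faceP 1 e; rewrite ?normr1. Qed.

Lemma below_face e : face D (fb e).
Proof. by have [] := @side_faceP (-1) e; rewrite ?normrN1. Qed.

Lemma above_near e x c : over x e -> h e x < c ->
  exists2 y, h e x < y < c & fa e (x, y).
Proof.
move=> ex hc; have [_ /(_ x ex) nF] := @side_faceP 1 e (normr1 _).
near (0 : R)^'+ => d; exists (h e x + 1 * d); last by near: d.
have : 0 < d by near: d; exact: nbhs_right_gt.
have : d < c - h e x by near: d; apply: nbhs_right_lt; rewrite subr_gt0.
lra.
Unshelve. all: end_near.
Qed.

Lemma below_near e x c : over x e -> c < h e x ->
  exists2 y, c < y < h e x & fb e (x, y).
Proof.
move=> ex hc; have [_ /(_ x ex) nF] := @side_faceP (-1) e (normrN1 _).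
near (0 : R)^'+ => d; exists (h e x + -1 * d); last by near: d.
have : 0 < d by near: d; exact: nbhs_right_gt.
have : d < h e x - c by near: d; apply: nbhs_right_lt; rewrite subr_gt0.
lra.
Unshelve. all: end_near.
Qed.

Lemma side_separates e : separates D e (fb e) (fa e).
Proof.
move=> x ex; have [_ /(_ x ex) nFa] := @side_faceP 1 e (normr1 _).
have [_ /(_ x ex) nFb] := @side_faceP (-1) e (normrN1 _).
near=> d; split.
  by rewrite -[- d]mulN1r; near: d.
by rewrite -[d]mul1r; near: d.
Unshelve. all: end_near.
Qed.

Lemma above_vertical e x y : over x e -> h e x < y ->
  (forall t, h e x < t <= y -> ~ support D (x, t)) -> fa e (x, y).
Proof.
move=> ex hy out; have [y' /andP[hy' y'y] Fy'] := above_near ex hy.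
apply: (face_vertical (D := D)) Fy'; first exact: above_face.
by move=> t; rewrite (min_l (ltW y'y)) (max_r (ltW y'y)) => tP; apply: out; lra.
Qed.

Lemma below_vertical e x y : over x e -> y < h e x ->
  (forall t, y <= t < h e x -> ~ support D (x, t)) -> fb e (x, y).
Proof.
move=> ex hy out; have [y' /andP[hy' y'y] Fy'] := below_near ex hy.
apply: (face_vertical (D := D)) Fy'; first exact: below_face.
by move=> t; rewrite (min_r (ltW hy')) (max_l (ltW hy')) => tP; apply: out; lra.
Qed.

(** * Edges and faces along a vertical line *)

Lemma generic_support x y : generic D x -> support D (x, y) ->
  exists2 e, over x e & y = h e x.
Proof.
move=> gx [[e _ [/= xe ye]]|[v _ [vx _]]]; last by case: (gx v).
by exists e => //; rewrite -generic_over.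
Qed.

Lemma bounded_above e e' x : over x e -> over x e' -> h e x < h e' x ->
  bounded_face D (fa e).
Proof.
move=> ex e'x lt_h; have [y /andP[y1 y2] Fy] := above_near ex lt_h.
rewrite (face_comp (above_face e) Fy).
apply: (between_bounded (face_out (above_face e) Fy)) y1 y2; exact: over_on.
Qed.

Lemma bounded_below e e' x : over x e -> over x e' -> h e x < h e' x ->
  bounded_face D (fb e').
Proof.
move=> ex e'x lt_h; have [y /andP[y1 y2] Fy] := below_near e'x lt_h.
rewrite (face_comp (below_face e') Fy).
apply: (between_bounded (face_out (below_face e') Fy)) y1 y2; exact: over_on.
Qed.

Lemma side_adj e x f f' : over x e -> over x f -> over x f' ->
  h f x < h e x -> h e x < h f' x -> face_adj D (fb e) (fa e).
Proof.
move=> ex fx f'x fe ef'; split; [exact: bounded_below fe|exact: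
  bounded_above ef'|].
by exists e; exact: side_separates.
Qed.

Lemma nearest_below x y f : over x f -> h f x < y -> exists e,
  [/\ over x e, h e x < y & forall e', over x e' -> h e' x < y ->
    h e' x <= h e x].
Proof.
move=> fx fy; pose A e := over x e && (h e x < y).
have Af : A f by rewrite /A fx.
case: (@arg_maxP _ R _ f A (fun e => h e x) Af) => e /andP[ex ey] eP.
by exists e; split=> // e' e'x e'y; apply: eP; rewrite /A e'x.
Qed.

Lemma nearest_above x y f : over x f -> y < h f x -> exists e,
  [/\ over x e, y < h e x & forall e', over x e' -> y < h e' x ->
    h e x <= h e' x].
Proof.
move=> fx fy; pose A e := over x e && (y < h e x).
have Af : A f by rewrite /A fx.
case: (@arg_minP _ R _ f A (fun e => h e x) Af) => e /andP[ex ey] eP.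
by exists e; split=> // e' e'x e'y; apply: eP; rewrite /A e'x.
Qed.

Lemma nearest_below_face x y f : generic D x -> ~ support D (x, y) ->
  over x f -> h f x < y -> exists e,
  [/\ over x e, h e x < y, fa e (x, y)
    & forall e', over x e' -> h e' x < y -> h e' x <= h e x].
Proof.
move=> gx out fx fy; have [e [ex ey eP]] := nearest_below fx fy.
exists e; split=> //; apply: above_vertical => // t /andP[et ty] tS.
have [e' e'x tE] := generic_support gx tS; rewrite tE in et ty.
have [E|N] := eqVneq (h e' x) y; first by apply: out; rewrite -E -tE.
have : h e' x < y by rewrite lt_neqAle N.
by move=> /(eP _ e'x); lra.
Qed.

Lemma nearest_above_face x y f : generic D x -> ~ support D (x, y) ->
  over x f -> y < h f x -> exists e,
  [/\ over x e, y < h e x & fb e (x, y)].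
Proof.
move=> gx out fx fy; have [e [ex ey eP]] := nearest_above fx fy.
exists e; split=> //; apply: below_vertical => // t /andP[yt te] tS.
have [e' e'x tE] := generic_support gx tS; rewrite tE in yt te.
have [E|N] := eqVneq (h e' x) y; first by apply: out; rewrite -E -tE.
have : y < h e' x by rewrite lt_neqAle eq_sym N.
by move=> /(eP _ e'x); lra.
Qed.

(** This is one step down the vertical line: the next edge below [e] shares with it the face in
    between. *)
Lemma previous_edge x e f : generic D x -> over x e -> over x f ->
  h f x < h e x -> exists e',
  [/\ over x e', h e' x < h e x, fa e' = fb e
    & forall g, over x g -> h g x < h e x -> h g x <= h e' x].
Proof.
move=> gx ex fx fe.
have [e1 [e1x e1e e1P]] := nearest_below fx fe.
have [y /andP[y1 y2] Fy] := below_near ex e1e.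
have out := face_out (below_face e) Fy.
have [e' [e'x e'y F'y e'P]] := nearest_below_face gx out e1x y1.
exists e'; split=> //; first lra.
  exact: face_eq (above_face _) (below_face _) F'y Fy.
by move=> g gx' /(e1P _ gx') ge1; apply: e'P => //; lra.
Qed.

(** The support is closed, so a point of the face can be moved slightly to the right, off the
    finitely many abscissae of vertices. *)
Lemma generic_point F : bounded_face D F -> exists x y, generic D x /\ F (x, y).
Proof.
move=> bF; have fF := bounded_face_face bF.
have [z Fz] : exists z, F z.
  by case: fF => z zS ->; exists z; exact: connected_component_refl.
have [r r0 rP] :=
  closed_ball_out (@support_closed_with _ _ _ D setT) (face_out fF Fz).
have [|x [zx xz xP]] :=
  @avoid_right _ [seq X v | v <- enum 'I_n.+1] z.1 (z.1 + r).
  by lra.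
exists x, z.2; split.
  move=> v xv; have := xP (X v); rewrite -xv ltxx xv map_f ?mem_enum // -xv.
  by move=> /(_ isT zx).
apply: (@face_horizontal _ _ _ D _ _ z.1) => //;
  last by rewrite -surjective_pairing.
move=> t; rewrite (min_l (ltW zx)) (max_r (ltW zx)) => tP; apply: rP => /=;
  last by rewrite subrr normr0.
by rewrite distrC ger0_norm; lra.
Qed.

Lemma bounded_face_point F : bounded_face D F -> exists x y f f',
  [/\ generic D x, F (x, y), over x f, over x f' & h f x < y < h f' x].
Proof.
move=> bF; have [x [y [gx Fxy]]] := generic_point bF.
have fF := bounded_face_face bF.
have [|f [f' /= [fx f'x fy yf']]] := bounded_between (face_out fF Fxy).
  by case: bF; rewrite (face_comp fF Fxy).
by exists x, y, f, f'; rewrite -!(generic_over _ gx) fy yf'.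
Qed.

(** As there are finitely many edges, this bounds the number of bounded faces. *)
Lemma bounded_face_above F : bounded_face D F -> exists e, F = fa e.
Proof.
move=> bF; have [x [y [f [f' [gx Fxy fx f'x /andP[fy yf']]]]]] :=
  bounded_face_point bF.
have fF := bounded_face_face bF.
have [e [_ _ Fe _]] := nearest_below_face gx (face_out fF Fxy) fx fy.
by exists e; exact: face_eq fF (above_face _) Fxy Fe.
Qed.

Lemma bounded_faces_finite : exists2 s : seq (set (R * R)), uniq s &
  forall F, F \in s <-> bounded_face D F.
Proof.
exists (undup [seq F <- [seq fa e | e <- enum (edge G)] | `[< bounded_face D F
  >]]).
  exact: undup_uniq.
move=> F; rewrite mem_undup mem_filter; split=> [/andP[/asboolP//]|bF].
apply/andP; split; first exact/asboolP.
by have [e ->] := bounded_face_above bF; apply/mapP; exists e;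
  rewrite ?mem_enum.
Qed.

End SideFaces.

(** * Routes of order ideals *)

Section Ideals.
Context (R : realType) (n : nat) (G : dgraph n) (D : drawing R G).
Context (D_planar : crossing_free D).
Implicit Types (p q P Q S : seq (edge G)) (e f : edge G) (u v w : 'I_n.+1).
Implicit Types (x y t s : R) (F : set (R * R)) (z : R * R).

Local Notation X := (abscissa D).
Local Notation h := (height D).
Local Notation over := (over_edge D).

Local Notation fa := (side_face D 1).
Local Notation fb := (side_face D (-1)).

(** Closure along [face_adj] amounts to closure along the order that it generates. *)
Definition face_ideal (I : set (set (R * R))) :=
  (forall F, I F -> bounded_face D F) /\
  (forall F F', face_adj D F F' -> I F' -> I F).

(** Going down the line from [e'] to [e], consecutive faces are adjacent, so membership in the ideal
    is inherited. The induction is on the number of edges below [e']. *)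
Lemma ideal_between I x e e' : face_ideal I -> generic D x -> over x e ->
  over x e' -> h e x < h e' x -> I (fb e') -> I (fa e).
Proof.
move=> [_ idI] gx ex; pose A g := [set f | over x f & h f x < h g x]%SET.
have [k] := ubnP #|A e'|; elim: k e' => // k IH e' leA e'x ee' Ie'.
have [f [fx fe' fE fP]] := previous_edge D_planar gx e'x ex ee'.
have [-> //|ef] := eqVneq e f; first by rewrite fE.
have {}ef : h e x < h f x.
  rewrite lt_neqAle fP // andbT; apply/eqP.
  by apply: (over_neq D_planar) (over_on fx) => //; exact/eqP.
apply: (IH f) => //.
  rewrite -ltnS (leq_trans _ leA) // ltnS; apply/proper_card/properP; split.
    by apply/fintype.subsetP => g; rewrite !inE => /andP[-> /lt_trans]; apply.
  by exists f; rewrite !inE fx ?fe' ?ltxx.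
by apply: idI (side_adj D_planar fx ex e'x ef fe') _; rewrite fE.
Qed.

(* The edges of the route [R_I]. *)
Definition cut_edge (I : set (set (R * R))) e :=
  (bounded_face D (fb e) -> I (fb e)) /\ ~ I (fa e).

(** Of two cut edges, the upper one has a bounded face below it, hence in [I]; this would put the
    face above the lower one in [I]. *)
Lemma cut_edge_unique I x e e' : face_ideal I -> generic D x -> over x e ->
  over x e' -> cut_edge I e -> cut_edge I e' -> e = e'.
Proof.
move=> idI gx; wlog lt_h : e e' / h e x < h e' x.
  move=> wl ex e'x ce ce'; apply: contrapT => ee'.
  have := over_neq D_planar ee' ex (over_on e'x).
  have [||] := ltgtP (h e x) (h e' x) => // lt_h _.
    by apply: ee'; exact: (wl e e').
  by apply: ee'; apply/esym; exact: (wl e' e).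
move=> ex e'x [_ Ie] [Ie' _]; case: Ie.
by apply: (ideal_between idI gx ex e'x lt_h); apply: Ie'; exact:
  bounded_below lt_h.
Qed.

(** Take the lowest edge on the line whose upper face is not in [I]. The topmost edge is a
    candidate, since its upper face is unbounded. *)
Lemma cut_edge_exists I x : face_ideal I -> generic D x ->
  X ord0 < x < X ord_max -> exists2 e, over x e & cut_edge I e.
Proof.
move=> [bI idI] gx xs.
have n0 : (0 < n)%N.
  by have : X ord0 < X ord_max by [lra]; rewrite abscissa_ltE.
have [P rP] := route_exists G n0.
have [f _] := edge_at rP xs; rewrite generic_over // => fx.
pose A e := over x e && `[< ~ I (fa e) >].
have [t [tx tP]] : exists t : edge G, over x t /\ forall e, over x e ->
  h e x <= h t x.
  case: (@arg_maxP _ R _ f (fun e => over x e) (fun e => h e x) fx) => t tx tP.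
  by exists t.
have At : A t.
  rewrite /A tx; apply/asboolP => /bI bt.
  have t1 : h t x < h t x + 1 by lra.
  have [y /andP[ty _] Fy] := above_near D_planar tx t1.
  have ft := bounded_face_face bt.
  have [|_ [e [_ /= ex _ ye]]] := bounded_between (face_out ft Fy).
    by case: bt; rewrite (face_comp ft Fy).
  by rewrite generic_over // in ex; have := tP e ex; lra.
case: (@arg_minP _ R _ t A (fun e => h e x) At) => e /andP[ex /asboolP Ie] eP.
exists e => //; split=> // be.
have e1 : h e x - 1 < h e x by lra.
have [y /andP[_ ye] Fy] := below_near D_planar ex e1.
have fe := bounded_face_face be.
have [|g [_ [/= gx' _ gy _]]] := bounded_between (face_out fe Fy).
  by case: be; rewrite (face_comp fe Fy).
rewrite generic_over // in gx'.
have [e' [e'x e'e <- _]] := previous_edge D_planar gx ex gx' (lt_trans gy ye).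
apply: contrapT => Ie'; have : A e' by rewrite /A e'x; apply/asboolP.
by move=> /eP; rewrite leNgt e'e.
Qed.

Lemma generic_right v : (v < n)%N -> exists x,
  [/\ generic D x, X ord0 < x < X ord_max
    & forall e, over x e -> (src e <= v)%N /\ (v < tgt e)%N].
Proof.
move=> vn; have vmax : X v < X ord_max by rewrite abscissa_ltE.
have [x [vx xm xP]] := avoid_right [seq X u | u <- enum 'I_n.+1] vmax.
have {}xP u : (v < u)%N -> x < X u.
  by move=> vu; apply: xP; rewrite ?abscissa_ltE // map_f ?mem_enum.
have xP' u : (u <= v)%N -> X u < x by move=> /(abscissa_le D) /le_lt_trans;
  apply.
exists x; split.
- by move=> u xu; have [/xP'|/xP] := leqP u v; rewrite xu ltxx.
- by rewrite xP'.
move=> e /andP[sx xt]; split.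
  by rewrite leqNgt; apply/negP => /xP; lra.
by rewrite ltnNge; apply/negP => /xP'; lra.
Qed.

Lemma generic_left u v : (u < v)%N -> exists x,
  generic D x /\ (forall e, (src e <= u)%N -> (v <= tgt e)%N -> over x e).
Proof.
move=> uv; have uvX : X u < X v by rewrite abscissa_ltE.
have [x [ux xv xP]] := avoid_left [seq X w | w <- enum 'I_n.+1] uvX.
have {}xP w : (w < v)%N -> X w < x.
  by move=> wv; apply: xP; rewrite ?abscissa_ltE // map_f ?mem_enum.
exists x; split.
  move=> w xw; have [/(abscissa_le D)|/xP] := leqP v w; last by rewrite xw ltxx.
  by rewrite -xw leNgt xv.
move=> e /(abscissa_le D) su /(abscissa_le D) vt; rewrite /over_edge; lra.
Qed.

(** Let a cut edge enter [t]. The cut edge on a line just right of [t] must start at [t]: otherwise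
    it passes over [t], and a line just left of [t] meets two cut edges. *)
Lemma cut_path I v : face_ideal I ->
  (v != ord_max -> exists2 e, cut_edge I e & src e = v) ->
  exists2 p, dipath v p ord_max & forall e, e \in p -> cut_edge I e.
Proof.
move=> idI; have [k] := ubnP (n - v); elim: k v => // k IH v lt_k cv.
have [->|vmax] := eqVneq v ord_max; first by exists [::] => //=.
have [e ce ev] := cv vmax.
have lt_vt : (v < tgt e)%N by rewrite -ev src_lt_tgt.
have [||p pt cp] := IH (tgt e).
- by have := ltn_ord (tgt e); lia.
- move=> tmax; have tn : (tgt e < n)%N.
    rewrite ltn_neqAle -ltnS ltn_ord andbT; apply: contra tmax => /eqP E.
    exact/eqP/val_inj.
  have [x [gx xs xP]] := generic_right tn.
  have [e' e'x ce'] := cut_edge_exists idI gx xs.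
  have [st tt'] := xP e' e'x; exists e' => //.
  have [lt_st|] := ltnP (src e') (tgt e); last first.
    by move=> ts; apply/val_inj/eqP; rewrite eqn_leq st.
  (* With [u] the later of the two sources, a line between [u] and [tgt e] crosses both edges. *)
  pose u := if (src e <= src e')%N then src e' else src e.
  have ut : (u < tgt e)%N by rewrite /u; case: ifP => // _; exact: src_lt_tgt.
  have [y [gy yP]] := generic_left ut.
  have /(congr1 tgt)/(congr1 val) /= tE : e = e'.
    apply: (cut_edge_unique idI gy _ _ ce ce'); apply: yP => //; try exact:
      ltnW.
      by rewrite /u; case: ifP.
    by rewrite /u; case: (leqP (src e) (src e')) => // /ltnW.
  by rewrite tE ltnn in tt'.
exists (e :: p); first by rewrite /= ev eqxx.
by move=> f; rewrite inE => /predU1P[-> //|/cp].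
Qed.

(** All edges crossing a line just right of the source start there, so the cut path begins at the
    source. The position of a face relative to it is read off on a generic line through the face. *)
Lemma ideal_route_exists I : face_ideal I -> exists P, route P /\
  forall F, bounded_face D F -> (below_route D F P <-> I F).
Proof.
move=> idI; have [|P rP cP] := @cut_path I ord0 idI.
  move=> max0; have n0 : (@ord0 n < n)%N.
    by rewrite lt0n; apply: contra max0 => /eqP n0; apply/eqP/val_inj;
      rewrite /= n0.
  have [x [gx xs xP]] := generic_right n0.
  have [e ex ce] := cut_edge_exists idI gx xs; exists e => //.
  by have [+ _] := xP e ex; rewrite leqn0 => /eqP s0; exact/val_inj.
exists P; split=> // F bF; have fF := bounded_face_face bF.
have [x [y [f [f' [gx Fxy fx f'x /andP[fy yf']]]]]] := bounded_face_point bF.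
have out := face_out fF Fxy.
have [e eP] := edge_at rP (face_strip bF Fxy); rewrite /= generic_over // => ex.
have [bI _] := idI; have [Ifb Ifa] := cP e eP.
rewrite (below_routeE bF rP Fxy) /= (ph_on rP eP (over_on ex)); split=> [ye|IF].
  have [e1 [e1x e1y Fe1 _]] := nearest_below_face D_planar gx out fx fy.
  rewrite (face_eq fF (above_face D_planar _) Fxy Fe1).
  have e1e := lt_trans e1y ye.
  apply: (ideal_between idI gx e1x ex e1e); apply: Ifb.
  exact: bounded_below e1e.
rewrite ltNge le_eqVlt; apply/negP => /predU1P[E|ey].
  by apply: out; left; exists e => //; split=> /=; [exact: over_on|].
have [e2 [e2x ye2 Fe2]] := nearest_above_face D_planar gx out f'x yf'.
apply: Ifa; apply: (ideal_between idI gx ex e2x (lt_trans ey ye2)).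
by rewrite -(face_eq fF (below_face D_planar _) Fxy Fe2).
Qed.

End Ideals.

(** * Linear extensions and maximal cliques *)

Section LinearExtensions.
Context (R : realType) (n : nat) (G : dgraph n) (D : drawing R G).
Context (D_planar : crossing_free D).
Implicit Types (p q P Q S : seq (edge G)) (e f : edge G) (u v w : 'I_n.+1).
Implicit Types (x y t s : R) (F : set (R * R)) (z : R * R).

Local Notation ph := (path_height D).

Local Notation below := (below_route D).

(** * Routes are determined by the faces below them *)

Lemma below_sub_le P Q : route P -> route Q ->
  (forall F, bounded_face D F -> below F P -> below F Q) ->
  forall x, ph P x <= ph Q x.
Proof.
move=> rP rQ sub x; rewrite leNgt;
  apply/negP => /(lt_face rQ rP)[F [bF FP nFQ]].
by apply: nFQ; exact: sub.
Qed.

Lemma below_inj P Q : route P -> route Q ->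
  (forall F, bounded_face D F -> below F P <-> below F Q) -> P = Q.
Proof.
move=> rP rQ PQ; apply: contrapT => /(ph_neq D_planar rP rQ)[x].
rewrite eq_le !below_sub_le // => F bF; exact: (PQ F bF).1 || exact:
  (PQ F bF).2.
Qed.

Lemma ideal_route_eq I P : route P ->
  (forall F, bounded_face D F -> (below F P <-> I F)) -> ideal_route D I = P.
Proof.
move=> rP PI; rewrite /ideal_route; case: xgetP => [Q _ [rQ QI]|/(_ P)[]//].
by apply: below_inj => // F bF; rewrite QI // PI.
Qed.

(** * From linear extensions to maximal cliques *)

Lemma take_ideal a k : linear_extension D a ->
  face_ideal D [set F | F \in take k a].
Proof.
move=> [ua aP leP]; split=> [F /mem_take|F F' adj /=]; first by rewrite aP.
have [bF bF' _] := adj; have Fa : F \in a by rewrite aP.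
have F'a : F' \in a by rewrite aP.
rewrite !in_take //; apply: leq_ltn_trans; apply: leP; rewrite ?index_mem //.
by rewrite !nth_index //; apply: rt_step.
Qed.

Lemma ideal_routeP a k : linear_extension D a ->
  let P := ideal_route D [set F | F \in take k a] in
  route P /\ forall F, bounded_face D F -> below F P <-> F \in take k a.
Proof.
move=> /(take_ideal k) /(ideal_route_exists D_planar) /(xgetPex [::]).
exact.
Qed.

Lemma bmap_clique a : linear_extension D a ->
  clique (planar_framing D) (bmap D a).
Proof.
move=> la; split=> [_ [k _ <-]|_ _ [k _ <-] [l _ <-]].
  by have [] := ideal_routeP k la.
have [rk kP] := ideal_routeP k la; have [rl lP] := ideal_routeP l la.
apply: noncrossing_coherent => //; have [kl|/ltnW lk] := leqP k l; [left|right].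
  apply: below_sub_le => // F bF; rewrite kP // lP //.
  by rewrite -(take_takel a kl) => /mem_take.
apply: below_sub_le => // F bF; rewrite kP // lP //.
by rewrite -(take_takel a lk) => /mem_take.
Qed.

Lemma noncrossing_below P Q : route P -> route Q -> noncrossing D P Q ->
  (forall F, bounded_face D F -> below F P -> below F Q) \/
  (forall F, bounded_face D F -> below F Q -> below F P).
Proof.
by move=> rP rQ [PQ|QP]; [left|right] => F bF; exact: le_below.
Qed.

(** Let [Q] be coherent with the whole clique, and take the largest [k] such that the first [k]
    faces are below [Q]. Comparing [Q] with the route of the first [k + 1] faces shows that no other
    face is below [Q]. *)
Lemma bmap_maximal a : linear_extension D a ->
  maximal_clique (planar_framing D) (bmap D a).
Proof.
move=> la; split; first exact: bmap_clique.
move=> C [rC cC] sub; apply/seteqP; split=> // Q CQ.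
have rQ := rC _ CQ; have [ua aP _] := la.
have cmp k : (k <= size a)%N ->
    (forall F, bounded_face D F -> below F Q -> F \in take k a) \/
    (forall F, bounded_face D F -> F \in take k a -> below F Q).
  move=> ka; have [rk kP] := ideal_routeP k la.
  have CR : C (ideal_route D [set F | F \in take k a]) by apply: sub; exists k.
  have := coherent_noncrossing D_planar rQ rk (cC _ _ CQ CR).
  by move=> /(noncrossing_below rQ rk)[] H; [left|right] => F bF;
    rewrite -kP //; exact: H.
pose A k := (k <= size a)%N && all (fun F => `[< below F Q >]) (take k a).
have exA : exists k, A k by exists 0%N; rewrite /A take0.
have ubA k : A k -> (k <= size a)%N by case/andP.
case: (ex_maxnP exA ubA) => k /andP[ka /allP kQ] kmax.
exists k => //; apply: ideal_route_eq => // F bF /=; split; last first.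
  by move=> /kQ /asboolP.
have Fa : F \in a by rewrite aP.
move: ka; rewrite leq_eqVlt => /predU1P[->|lt_ka]; first by rewrite take_size.
have nQ : ~ below (nth set0 a k) Q.
  move=> nQ; have /kmax : A k.+1; last by rewrite ltnn.
  rewrite /A lt_ka (take_nth set0) // all_rcons /=; apply/andP; split.
    exact/asboolP.
  exact/allP.
have [kP|kP] := cmp _ lt_ka.
  move=> FQ; have := kP F bF FQ; rewrite (take_nth set0) // mem_rcons inE.
  by move=> /predU1P[FE|//]; rewrite FE in FQ.
case: nQ; apply: kP; first by rewrite -aP mem_nth.
by rewrite (take_nth set0) // mem_rcons mem_head.
Qed.

Lemma linear_extension_size a a' : linear_extension D a ->
  linear_extension D a' -> size a = size a'.
Proof.
move=> [ua aP _] [ua' a'P _]; apply/perm_size/uniq_perm => // F.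
by apply/idP/idP; rewrite aP a'P.
Qed.

Lemma bmap_inj a a' : linear_extension D a -> linear_extension D a' ->
  bmap D a = bmap D a' -> a = a'.
Proof.
move=> la la' E; have sE := linear_extension_size la la'.
have [ua aP _] := la; have [ua' a'P _] := la'.
have tE k : (k <= size a)%N -> take k a =i take k a'.
  move=> ka; have : bmap D a (ideal_route D [set F | F \in take k a]) by exists
    k.
  rewrite E => -[l /= la'l lE].
  have [_ kP] := ideal_routeP k la; have [_ lP] := ideal_routeP l la'.
  have tE : take k a =i take l a'.
    move=> F; apply/idP/idP => Ft.
      have bF : bounded_face D F by rewrite -aP (mem_take Ft).
      by apply/lP => //; rewrite lE; apply/kP.
    have bF : bounded_face D F by rewrite -a'P (mem_take Ft).
    by apply/kP => //; rewrite -lE; apply/lP.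
  (* The number of faces below a route fixes its index in both extensions. *)
  suff kl : k = l by rewrite {2}kl.
  have /perm_size : perm_eq (take k a) (take l a') by apply: uniq_perm;
    rewrite ?take_uniq.
  by rewrite !size_takel.
have iE F : F \in a -> index F a = index F a'.
  move=> Fa; have Fa' : F \in a' by rewrite a'P -aP.
  apply/eqP; rewrite eqn_leq; apply/andP; split.
    rewrite -ltnS -(in_take _ Fa) tE ?in_take // sE index_mem //.
  by rewrite -ltnS -(in_take _ Fa') -tE ?in_take // index_mem.
apply: (@eq_from_nth _ set0) => // i ia.
rewrite -{2}(index_uniq set0 ia ua) iE ?mem_nth // nth_index //.
by rewrite a'P -aP mem_nth.
Qed.

(* Routes are recorded by their edge sets, so as to be counted in a finite
   type. *)
Definition routes_above (A : set (seq (edge G))) F : {set {set edge G}} :=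
  [set B : {set edge G} | `[< exists2 P, A P & [/\ route P, below F P
    & B = [set e in P]%SET] >]]%SET.

Lemma routes_above_sub A F F' :
  (forall P, A P -> route P -> below F' P -> below F P) ->
  routes_above A F' \subset routes_above A F.
Proof.
move=> sub; apply/fintype.subsetP => B;
  rewrite !finset.in_set => /asboolP[P AP [rP FP BE]].
by apply/asboolP; exists P => //; split=> //; exact: sub.
Qed.

Lemma routes_above_lt A F F' P : A P -> route P -> below F P -> ~ below F' P ->
  (forall P, A P -> route P -> below F' P -> below F P) ->
  (#|routes_above A F'| < #|routes_above A F|)%N.
Proof.
move=> AP rP FP nF'P sub; apply/proper_card/properP; split.
  exact: routes_above_sub.
exists [set e in P]%SET; rewrite finset.in_set; first by apply/asboolP;
  exists P.
(* Passing to edge sets is harmless: [below_route] depends only on which edges occur in the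
   route. *)
apply/asboolP => -[Q _ [_ F'Q PQ]]; apply: nF'P => z /F'Q[e eQ ez].
by exists e => //; move: PQ => /setP /(_ e); rewrite !finset.in_set eQ.
Qed.

(* Lexicographic: sorting by decreasing [face_key A] respects the face order,
   by the second component, and puts the faces below a route of the chain [A]
   before the others, by the first one. *)
Definition face_key A F :=
  (#|routes_above A F| * #|{set edge G}|.+1 + #|routes_above setT F|)%N.

(** Every route above [F'] is above [F], so neither component increases; the second drops because of
    a route through the common edge. *)
Lemma face_key_adj A F F' : face_adj D F F' -> (face_key A F' < face_key A F)%N.
Proof.
move=> adj; have [P [rP FP nF'P]] := adj_separated adj.
rewrite /face_key -addnS leq_add ?leq_mul2r //.
  apply/orP; right; apply/subset_leq_card/routes_above_sub => Q _ rQ.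
  exact: (adj_below rQ adj).
apply: (@routes_above_lt _ _ _ P) => // Q _ rQ; exact: (adj_below rQ adj).
Qed.

Lemma face_key_le A F F' : face_le D F F' ->
  F = F' \/ (face_key A F' < face_key A F)%N.
Proof.
elim=> [{}F {}F' /(face_key_adj A)|{}F|F1 F2 F3 _ [->//|lt12] _ [<-|lt23]].
- by right.
- by left.
- by right.
- by right; exact: ltn_trans lt12.
Qed.

(** A route of the chain above [F'] cannot lie below [P], so it lies above [P] and hence above [F].
    Thus the first component of the key drops. *)
Lemma face_key_chain C F F' P : clique (planar_framing D) C -> C P ->
  bounded_face D F -> bounded_face D F' -> below F P -> ~ below F' P ->
  (face_key C F' < face_key C F)%N.
Proof.
move=> [rC cC] CP bF bF' FP nF'P.
have lt_C : (#|routes_above C F'| < #|routes_above C F|)%N.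
  apply: (@routes_above_lt _ _ _ P) => //; first exact: rC.
  move=> Q CQ rQ F'Q; have rP := rC _ CP.
  have := coherent_noncrossing D_planar rP rQ (cC _ _ CP CQ).
  by move=> /(noncrossing_below rP rQ)[/(_ F bF FP)//|/(_ F' bF' F'Q)].
(* The weight of the first component exceeds every value of the second. *)
have leN : (#|routes_above setT F'| <= #|{set edge G}|)%N by exact: max_card.
rewrite /face_key -addnS (leq_trans _ (leq_addr _ _)) //.
apply: leq_trans (leq_mul lt_C (leqnn _)).
by rewrite mulSn [leqRHS]addnC leq_add2l ltnS.
Qed.

(** Sort the bounded faces by decreasing key. For each route of the clique, the faces below it then
    come first. *)
Lemma clique_sub_bmap C : clique (planar_framing D) C ->
  exists2 a, linear_extension D a & C `<=` bmap D a.
Proof.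
move=> cC; have [s us sP] := bounded_faces_finite D_planar.
pose le F F' := (face_key C F' <= face_key C F)%N.
have le_total : total le by move=> F F'; exact: leq_total.
have le_tr : transitive le by move=> F1 F2 F3 le12 le23; exact:
  leq_trans le23 le12.
pose a := sort le s.
have aP F : F \in a <-> bounded_face D F by rewrite mem_sort.
have ua : uniq a by rewrite sort_uniq.
have le_nth i j : (i <= j)%N -> (j < size a)%N ->
    (face_key C (nth set0 a j) <= face_key C (nth set0 a i))%N.
  move=> ij ja;
    apply: (sorted_leq_nth le_tr _ set0 (sort_sorted le_total s)) => //.
  - by move=> F; exact: leqnn.
  - by rewrite inE (leq_ltn_trans ij ja).
exists a.
  split=> // i j ia ja /(face_key_le C)[/eqP|lt_key].
    by rewrite nth_uniq // => /eqP ->.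
  by rewrite leqNgt; apply/negP => /ltnW /le_nth /(_ ia); rewrite leqNgt lt_key.
move=> P CP; have rP : route P by case: cC => /(_ _ CP).
(* The index [k] of the first face not below [P] is the size of [a] when all faces are below [P]. *)
pose nb F := ~~ `[< below F P >]; pose k := find nb a.
exists k; first exact: find_size.
apply: ideal_route_eq => // F bF /=; have Fa : F \in a by rewrite aP.
rewrite in_take //; split=> [FP|lt_k]; last first.
  have := before_find set0 lt_k; rewrite nth_index // => /negbFE /asboolP //.
rewrite ltnNge; apply/negP => k_le.
have nba : has nb a by rewrite has_find (leq_ltn_trans k_le) // index_mem.
have := nth_find set0 nba => /asboolPn nP.
have bk : bounded_face D (nth set0 a k) by rewrite -aP mem_nth // -has_find.
have := face_key_chain cC CP bF bk FP nP.
have := le_nth _ _ k_le; rewrite index_mem nth_index // => /(_ Fa).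
by rewrite leqNgt => /negbTE ->.
Qed.

End LinearExtensions.

Theorem theorem5p2 (R : realType) (n : nat) (G : dgraph n) (D : drawing R G)
    (D_planar : crossing_free D) :
  set_bij [set a | linear_extension D a]
          [set C | maximal_clique (planar_framing D) C]
          (bmap D).
Proof.
split=> [a /= la|a a' /set_mem la /set_mem la'|C [cC maxC]].
- exact: bmap_maximal.
- exact: bmap_inj.
(* A maximal clique contained in the clique [bmap D a] equals it. *)
- have [a la Ca] := clique_sub_bmap D_planar cC; exists a => //.
  by apply: maxC => //; exact: bmap_clique.
Qed.
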